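(* Let $X,Y$ be real numbers with $\frac32\le X\le Y$. Then $$ M(X,Y)=4Y^2\sum_{q=1}^{\infty}\frac{\varphi(q)}{q}\,F\Big(\Big[\frac{X}{q}\Big]\Big)+O\big((XY)^{3/2}(\log X)\log Y\big), $$ where the implied constant is absolute.
   Context: For $\mathbf{x}=(x_0,x_1,x_2)\in\mathbb{Z}^3$ write $|\mathbf{x}|=\max(|x_0|,|x_1|,|x_2|)$. $M(X,Y)$ denotes the number of pairs $\mathbf{x}=(x_0,x_1,x_2)$, $\mathbf{y}=(y_0,y_1,y_2)$ in $(\mathbb{Z}\setminus\{0\})^3$ (all six coordinates non-zero) with $x_0y_0+x_1y_1+x_2y_2=0$, $|\mathbf{x}|\le X$ and $|\mathbf{y}|\le Y$. For integers $n\ge 0$ put $$A(n)=\sum_{1\le j\le n}\frac1j,\qquad B(n)=\sum_{1\le j\le n}\frac1{j^2},$$ $$F(n)=\Big(\frac{33}{2}-3B(n)\Big)n^2-\Big(\frac{21}{2}+3B(n)\Big)n+6A(n);$$ empty sums are $0$, so $F(0)=0$. $[t]$ denotes the integer part of $t$ and $\varphi$ is Euler's totient function. *)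

(* Defs.v *)
From HB Require Import structures.
From mathcomp Require Import all_boot all_order all_algebra.
From mathcomp Require Import finmap.
From mathcomp Require Import all_classical all_reals all_analysis.

Set Implicit Arguments.
Unset Strict Implicit.
Unset Printing Implicit Defensive.

Import Order.TTheory GRing.Theory Num.Theory.
Import numFieldNormedType.Exports.

Local Open Scope classical_set_scope.
Local Open Scope ring_scope.

Definition supnorm (x : 'rV[int]_3) : nat := \max_(i < 3) `|x ord0 i|%N.

Definition Msol (R : realType) (X Y : R) : set ('rV[int]_3 * 'rV[int]_3) :=
  [set xy : 'rV[int]_3 * 'rV[int]_3 |
           [/\ forall i, xy.1 0 i != 0, forall i, xy.2 0 i != 0,
                \sum_(i < 3) xy.1 0 i * xy.2 0 i = 0,
                (supnorm xy.1)%:R <= X & (supnorm xy.2)%:R <= Y]].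

(* [fset_set] is the empty set on infinite sets; [finite_Msol] below shows that
   this case never occurs, so that [M X Y] is the number of elements of
   [Msol X Y]. *)
Definition M (R : realType) (X Y : R) : nat := #|` fset_set (Msol X Y)|.

Definition A (R : realType) (n : nat) : R := \sum_(1 <= j < n.+1) j%:R^-1.

Definition B (R : realType) (n : nat) : R :=
  \sum_(1 <= j < n.+1) (j%:R ^+ 2)^-1.

Definition F (R : realType) (n : nat) : R :=
  (33%:R / 2%:R - 3%:R * B R n) * n%:R ^+ 2
  - (21%:R / 2%:R + 3%:R * B R n) * n%:R + 6%:R * A R n.

Lemma finite_supnorm (R : realType) (X : R) :
  finite_set [set x : 'rV[int]_3 | (supnorm x)%:R <= X].
Proof.
set N := Num.truncn X.
pose f (u : {ffun 'I_3 -> 'I_(N + N).+1}) : 'rV[int]_3 :=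
  \row_i ((u i : nat)%:Z - N%:Z).
apply: (@sub_finite_set _ _ (f @` setT)); last first.
  by apply: finite_image; exact: finite_finset.
move=> x /= xX.
have X0 : 0 <= X by apply: le_trans xX.
have xN : (supnorm x <= N)%N by rewrite /N truncn_ge_nat.
have bnd i : (`|x ord0 i| <= N)%N.
  by apply: leq_trans xN; rewrite /supnorm (bigD1 i) //= leq_maxl.
have bnd2 i : - N%:Z <= x 0 i <= N%:Z.
  by rewrite -ler_norml -abszE lez_nat bnd.
exists [ffun i => inord (absz (x 0 i + N%:Z))] => //.
apply/rowP => i; rewrite mxE ffunE.
have /andP[lo hi] := bnd2 i.
have ge0 : 0 <= x 0 i + N%:Z by rewrite -lerBlDr sub0r.
rewrite inordK ?gez0_abs ?addrK // ltnS -lez_nat gez0_abs // PoszD.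
by rewrite lerD2r.
Qed.

Lemma finite_Msol (R : realType) (X Y : R) : finite_set (Msol X Y).
Proof.
apply: (sub_finite_set _ (finite_setX (finite_supnorm X) (finite_supnorm Y))).
by case=> x y [].
Qed.

(* For [0 <= t], the natural number [Num.truncn t] is the integer part of [t];
   the terms of the series below vanish for [q > X]. *)
Lemma is_cvg_main_series (R : realType) (X : R) : 0 <= X ->
  cvgn (fun n => \sum_(1 <= q < n)
    ((totient q)%:R / q%:R * F R (Num.truncn (X / q%:R)))).
Proof.
move=> X0; set N := (Num.truncn X).+1.
have F0 : F R 0 = 0.
  by rewrite /F /A /B !big_geq // expr0n /= !mulr0 subr0 addr0.
apply: (is_cvg_near_cst (\sum_(1 <= q < N)
  ((totient q)%:R / q%:R * F R (Num.truncn (X / q%:R))))).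
exists N => // n /= Nn.
rewrite (big_cat_nat _ Nn) //= [X in _ + X]big_nat.
rewrite [X in _ + X]big1 ?addr0 // => q.
case/andP=> Nq _; have q0 : (0 < q)%N by apply: leq_trans Nq.
suff -> : Num.truncn (X / q%:R) = 0%N by rewrite F0 mulr0.
apply/eqP; rewrite -leqn0 truncn_le_nat ltr_pdivrMr ?ltr0n // mul1r.
by apply: lt_le_trans (truncnS_gt X) _; rewrite ler_nat.
Qed.

(* Main.v *)
Require Import Defs.
From HB Require Import structures.
From mathcomp Require Import all_boot all_order all_algebra.
From mathcomp Require Import all_classical all_reals all_analysis.
From mathcomp Require Import finmap complex cyclic.
From mathcomp Require Import zify ring lra.
Import Order.TTheory GRing.Theory Num.Theory.
Import numFieldNormedType.Exports.
Local Open Scope classical_set_scope.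
Local Open Scope ring_scope.
Set Implicit Arguments.
Unset Strict Implicit.
Unset Printing Implicit Defensive.

(** Fix a vector of coefficients (a, b, c). Changing the signs of x and y in
    the same coordinate preserves the equation, so M (X, Y) is 8 times the
    number of solutions with a, b, c in [1, n] and y in the cube |y_i| <= L,
    where n = [X] and L = [Y] ([M_card], [card_code_sol]).

    If (a, b, c) is primitive, the solutions y are the points of a plane lattice
    in a polygon, and their number is L^2 [density a b c] up to an error. For a
    single vector this error can be of order L, because the lattice may have a
    short vector, and the worst-case bound is too weak after summation over the
    vectors. What makes the theorem true is that the error is much smaller on
    average. To see this, let c be the largest coefficient. The polygon is a
    square without two opposite triangles, of the same size by the symmetry
    y -> - y ([square_count_split]). On each line on which the second coordinate
    is constant, the number of points in the square or the triangle is an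
    explicit linear function minus fractional parts ([count_residue_class],
    [popoviciu]). Along the family of lines the fractional parts form arithmetic
    progressions modulo 1 with slopes like b a' / c', where a' is an inverse of
    a / gcd (a, c) modulo c' = c / gcd (a, c). Fourier analysis on Z / q bounds
    the sum of such a progression, whatever its length, by a sum of reciprocals
    of the chords cut by q-th roots of unity ([sawtooth_sum]); averaged over b,
    which runs through all slopes modulo q evenly, this bound is O(log^2)
    ([sum_saw_err]). Altogether the errors of the vectors in [1, n]^3 sum to
    O((n^3 + n^2 L) A(n)^2) ([sum3_plane_err], [total_count_bound]), where a
    vector h (a, b, c) counts like (a, b, c).

    Since n <= X <= Y, both n^3 and n^2 L are at most (X Y)^(3/2), and the
    harmonic number A(n) is O(log X), so this is the error term of the theorem.

    The main term is exact: 8 Y^2 times the sum of gcd (a, b, c) density (a, b, c)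
    over [1, n]^3. Writing the gcd as the sum of phi(q) over its divisors q turns
    it into the sum over q of phi(q) / q times the sum of the density over
    [1, n / q]^3 ([main_term_sum3]), and the latter has the closed form F / 2
    ([F_sum3_density]). *)

(** * Fourier analysis of residues modulo q *)

Lemma sum_unity_root (C : fieldType) q (z : C) :
  z ^+ q = 1 -> z != 1 -> \sum_(k < q) z ^+ k = 0.
Proof.
move=> zq z1; apply: (@mulfI _ (z - 1)); first by rewrite subr_eq0.
by rewrite -subrX1 zq subrr mulr0.
Qed.

(** When z is a q-th root of unity other than 1, the right-hand side is - q z;
    this gives the exact modulus q / |z - 1| of the Fourier coefficients of the
    function m |-> m mod q. *)
Lemma weighted_geometric_sum (C : fieldType) q (z : C) :
  (z - 1) * (\sum_(n < q) n%:R * z ^+ (q - n)) =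
  z * (\sum_(k < q) z ^+ k) - q%:R * z.
Proof.
elim: q => [|q IH]; first by rewrite !big_ord0 !mulr0 mul0r subrr.
rewrite big_ord_recr /= subSnn expr1 big_ord_recl /=.
under eq_bigr => i _ do rewrite subSn ?(ltnW (ltn_ord i)) // exprS mulrCA.
under [in RHS]eq_bigr => i _ do rewrite /bump /= add1n exprS.
rewrite -!mulr_sumr mulrDr mulrCA IH expr0 -natr1.
ring.
Qed.

(** Fourier inversion on Z / q, with (w^h)^(q - n) in the place of w^(- h n): the
    sum over h of w^(h (m - n)) vanishes unless n = m. *)
Lemma fourier_residue (C : fieldType) q (w : C) m :
  q.-primitive_root w -> (m < q)%N ->
  q%:R * m%:R = \sum_(h < q) w ^+ (h * m) * \sum_(n < q) n%:R * (w ^+ h) ^+ (q - n).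
Proof.
move=> pw mq.
have E (h n : 'I_q) : w ^+ (h * m) * (n%:R * (w ^+ h) ^+ (q - n)) =
    n%:R * (w ^+ (m + (q - n))) ^+ h.
  by rewrite mulrCA -!exprM -exprD -mulnDr mulnC.
under eq_bigr => h _.
  rewrite mulr_sumr; under eq_bigr => n _ do rewrite E.
  over.
rewrite exchange_big /= (bigD1 (Ordinal mq)) //= [X in _ = _ + X]big1 ?addr0; last first.
  move=> n nm; rewrite -mulr_sumr sum_unity_root ?mulr0 //.
    by rewrite -exprM mulnC exprM (prim_expr_order pw) expr1n.
  rewrite -(prim_order_dvd pw); apply: contra nm => /dvdnP [k kE].
  apply/eqP/val_inj => /=; have := ltn_ord n.
  case: k kE => [|[|k]]; lia.
rewrite subnKC ?(ltnW mq) // (prim_expr_order pw).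
under eq_bigr => i _ do rewrite expr1n mulr1.
by rewrite sumr_const card_ord mulr_natl.
Qed.

(** A frequency h with w^(h r) = 1 contributes the same amount to every term of
    the progression, so it cancels in the difference. For the other frequencies
    the sum over k is a geometric sum, at most 2 / |w^(h r) - 1|, which vanishes
    over a full period. The frequencies that cancel have no weight in the bound
    because 0^-1 = 0. *)
Lemma sawtooth_fourier (C : numFieldType) q (w : C) t r K :
  q.-primitive_root w -> `|w| = 1 ->
  `|\sum_(k < K) ((t + r * k) %% q)%:R
     - K%:R / q%:R * \sum_(k < q) ((t + r * k) %% q)%:R|
  <= 2 * \sum_(h < q) (`|w ^+ h - 1|^-1 * `|w ^+ (h * r) - 1|^-1).
Proof.
move=> pw nw.
have q0 : (0 < q)%N by exact: prim_order_gt0 pw.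
pose S h := \sum_(n < q) n%:R * (w ^+ h) ^+ (q - n).
pose G (h : nat) K := \sum_(k < K) (w ^+ (h * r)) ^+ k.
have main K' : q%:R * \sum_(k < K') ((t + r * k) %% q)%:R =
    \sum_(h < q) w ^+ (h * t) * S h * G h K'.
  rewrite mulr_sumr.
  under eq_bigr => k _.
    rewrite (fourier_residue pw) ?ltn_pmod //.
    under eq_bigr => h _.
      rewrite -(_ : w ^+ (h * t) * (w ^+ (h * r)) ^+ k =
          w ^+ (h * ((t + r * k) %% q))); last first.
        rewrite -exprM -exprD -mulnA -mulnDr.
        by rewrite -(prim_expr_mod pw) -modnMmr (prim_expr_mod pw).
      rewrite mulrAC.
      over.
    over.
  rewrite exchange_big /=; apply: eq_bigr => h _.
  by rewrite -mulr_sumr.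
have qR : q%:R != 0 :> C by rewrite pnatr_eq0 -lt0n.
have nwX n : `|w ^+ n| = 1 by rewrite normrX nw expr1n.
rewrite -(ler_pM2l (_ : 0 < q%:R)) ?ltr0n //.
rewrite -[X in X * `|_|]normr_nat -normrM mulrBr mulrA mulrCA divff // mulr1.
have -> : K%:R * \sum_(k < q) ((t + r * k) %% q)%:R =
   \sum_(h < q) w ^+ (h * t) * S h * (K%:R / q%:R * G h q).
  rewrite -{1}(divfK qR K%:R) -[_ / _ * _ * _]mulrA main mulr_sumr.
  by apply: eq_bigr => h _; rewrite mulrCA.
rewrite main -sumrB mulrA mulr_sumr.
apply: le_trans (ler_norm_sum _ _ _) _; apply: ler_sum => h _.
rewrite -mulrBr !normrM nwX mul1r.
have [z1|z1] := eqVneq (w ^+ (h * r)) 1.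
  rewrite /G z1; under eq_bigr => i _ do rewrite expr1n.
  under [in X in _ - X]eq_bigr => i _ do rewrite expr1n.
  by rewrite !sumr_const !card_ord -[1 *+ q]/(q%:R) divfK // !subrr !normr0 invr0 !mulr0.
have zq : (w ^+ (h * r)) ^+ q = 1.
  by rewrite -exprM mulnC exprM (prim_expr_order pw) expr1n.
have -> : G h q = 0 by exact: sum_unity_root.
rewrite mulr0 subr0.
have h1 : w ^+ h != 1.
  by apply: contra z1 => /eqP e; rewrite exprM e expr1n.
have hq : (w ^+ h) ^+ q = 1.
  by rewrite -exprM mulnC exprM (prim_expr_order pw) expr1n.
have -> : `|S h| = q%:R / `|w ^+ h - 1|.
  have := weighted_geometric_sum q (w ^+ h); rewrite -/(S h) sum_unity_root //.
  rewrite mulr0 sub0r => /(congr1 (fun x => `|x|)).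
  rewrite normrM normrN normrM nwX mulr1 normr_nat => <-.
  by rewrite mulrAC divff ?mul1r // normr_eq0 subr_eq0.
have -> : `|G h K| = `|(w ^+ (h * r)) ^+ K - 1| / `|w ^+ (h * r) - 1|.
  by rewrite subrX1 normrM mulrAC divff ?mul1r // normr_eq0 subr_eq0.
rewrite [X in _ <= X](_ : _ =
  q%:R / `|w ^+ h - 1| * (2 / `|w ^+ (h * r) - 1|)); last by ring.
rewrite ler_wpM2l ?divr_ge0 // ler_wpM2r ?invr_ge0 //.
apply: le_trans (ler_normB _ _) _.
by rewrite normrX nwX expr1n normr1.
Qed.

(** * Chords of the unit circle *)

(** By the mean value theorem sin (x / 2) is at least (x / 2) cos (x / 2), and
    sin x = 2 sin (x / 2) cos (x / 2), where cos (x / 2)^2 >= 1 / 2 because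
    cos x >= 0. *)
Lemma half_le_sin (R : realType) (x : R) : 0 <= x <= pi / 2 -> x / 2 <= sin x.
Proof.
move=> /andP[x0 xp]; have := @pi_gt0 R => p0.
have [||c cx] := @MVT_segment R sin cos 0 (x / 2).
- lra.
- by apply: continuous_subspaceT => y; exact: continuous_sin.
rewrite sin0 !subr0 => sE.
have c2 : cos (x / 2) <= cos c.
  move: cx; rewrite in_itv /= => /andP[? ?]; rewrite leNgt ltr_cos ?in_itv /=.
  - by rewrite -leNgt.
  - by apply/andP; split; lra.
  - by apply/andP; split; lra.
have xE : x = x / 2 *+ 2 by rewrite -mulr_natr divfK.
have cx0 : 0 <= cos x by apply: cos_ge0_pihalf; apply/andP; split; lra.
have c0 : 0 <= cos (x / 2) by apply: cos_ge0_pihalf; apply/andP; split; lra.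
have -> : sin x = 2 * (cos (x / 2) * (cos c * (x / 2))).
  by rewrite [in LHS]xE sin_mulr2n sE -mulr_natl.
have : cos x = 2 * cos (x / 2) ^+ 2 - 1.
  by rewrite [in LHS]xE cos_mulr2n -mulr_natl.
move: cx0 c2 x0 c0 {cx sE xE xp}.
set C := cos x; set D := cos (x / 2); set E := cos c => cx0 c2 x0 c0 CE.
have : D * D * x <= D * E * x by rewrite ler_wpM2r // ler_wpM2l.
nra.
Qed.

(** The reciprocal of the chord |e(m / q) - 1|. It is 0 if q divides m, by the
    convention 0^-1 = 0, so that sums over frequencies need no side condition. *)
Definition inv_chord (R : realType) (q m : nat) : R :=
  (2 * `|sin (pi * (m%:R / q%:R))|)^-1.

Lemma inv_chord_ge0 (R : realType) q m : 0 <= inv_chord R q m.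
Proof. by rewrite invr_ge0 mulr_ge0. Qed.

Section RootOfUnity.
Local Open Scope complex_scope.

Definition unit_root (R : realType) (q : nat) : R[i] :=
  cos (pi * 2 / q%:R) +i* sin (pi * 2 / q%:R).

Lemma unit_rootX (R : realType) q m : unit_root R q ^+ m =
  cos (pi * 2 / q%:R * m%:R) +i* sin (pi * 2 / q%:R * m%:R).
Proof.
elim: m => [|m IH]; first by rewrite mulr0 cos0 sin0 expr0.
have E : pi * 2 / q%:R * m.+1%:R = pi * 2 / q%:R + pi * 2 / q%:R * m%:R :> R.
  by rewrite -[m.+1%:R]natr1; ring.
rewrite exprS IH E cosD sinD /unit_root.
move: (cos _) (sin _) (cos _) (sin _) => x y z t.
by rewrite [t * x + _]addrC.
Qed.

Lemma norm_unit_root (R : realType) q : `|unit_root R q| = 1.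
Proof. by rewrite normc_def /= cos2Dsin2 sqrtr1. Qed.

Lemma inv_norm_unit_rootX_sub1 (R : realType) q m :
  `|unit_root R q ^+ m - 1|^-1 = (inv_chord R q m)%:C.
Proof.
rewrite unit_rootX normc_def /= subr0.
have -> : pi * 2 / q%:R * m%:R = (pi * (m%:R / q%:R) : R) *+ 2.
  by rewrite -[RHS]mulr_natr; ring.
set x : R := pi * _.
rewrite sin_mulr2n cos_mulr2n.
rewrite (_ : _ + _ = (2 * `|sin x|) ^+ 2); last first.
  rewrite exprMn real_normK ?num_real //; have := cos2sin2 x.
  move: (cos x) (sin x) => c s c2.
  transitivity ((c ^+ 2 *+ 2 - 1 - 1) ^+ 2 + 2 ^+ 2 * c ^+ 2 * s ^+ 2); first by ring.
  by rewrite c2; ring.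
by rewrite sqrtr_sqr ger0_norm ?mulr_ge0 // /inv_chord fmorphV.
Qed.

Lemma unit_root_primitive (R : realType) q :
  (0 < q)%N -> q.-primitive_root (unit_root R q).
Proof.
move=> q0; have qR : q%:R != 0 :> R by rewrite pnatr_eq0 -lt0n.
apply/andP; split=> //; apply/forallP => i; apply/eqP.
rewrite unity_rootE; have [->|iq] := eqVneq i.+1 q.
  by rewrite unit_rootX divfK // mulr_natr cos2pi sin2pi eqxx.
apply/negbTE; rewrite -subr_eq0 -normr_eq0 -invr_eq0 inv_norm_unit_rootX_sub1.
have ilt : (i.+1 < q)%N by rewrite ltn_neqAle iq ltn_ord.
rewrite fmorph_eq0 invr_eq0 mulf_neq0 ?normr_eq0 ?pnatr_eq0 //.
rewrite gt_eqF // sin_gt0_pi // mulr_gt0 ?pi_gt0 ?divr_gt0 ?ltr0n //=.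
by rewrite -[ltRHS]mulr1 ltr_pM2l ?pi_gt0 // ltr_pdivrMr ?ltr0n // mul1r ltr_nat.
Qed.

End RootOfUnity.

Lemma inv_chord_mod (R : realType) q m : (0 < q)%N -> inv_chord R q (m %% q) = inv_chord R q m.
Proof.
move=> q0; apply: (@complexI R); rewrite -!inv_norm_unit_rootX_sub1.
by rewrite (prim_expr_mod (unit_root_primitive R q0)).
Qed.

Lemma inv_chord_mulr (R : realType) d q m : (0 < d)%N -> inv_chord R (d * q) (d * m) = inv_chord R q m.
Proof.
move=> d0; rewrite /inv_chord !natrM; congr (2 * `|sin (pi * _)|)^-1.
by rewrite -mulf_div divff ?mul1r // pnatr_eq0 -lt0n.
Qed.

(** One of the angles pi m / q and pi - pi m / q is at most pi / 2, where
    [half_le_sin] applies. *)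
Lemma inv_chord_le (R : realType) q m : (0 < m < q)%N ->
  inv_chord R q m <= q%:R / 2 * (m%:R^-1 + (q - m)%:R^-1).
Proof.
have H x n : (0 < n)%N -> (2 * n <= q)%N -> x = pi * (n%:R / q%:R) :> R ->
    (2 * `|sin x|)^-1 <= q%:R / 2 * n%:R^-1.
  move=> n0 nq xE; have q0 : (0 < q)%N by lia.
  have qR : 0 < q%:R :> R by rewrite ltr0n.
  have nR : 0 < n%:R :> R by rewrite ltr0n.
  have p2 := @pi_ge2 R; have x0 : 0 <= x by rewrite xE mulr_ge0 ?divr_ge0 // pi_ge0.
  have nq2 : n%:R / q%:R <= 2^-1 :> R.
    by rewrite ler_pdivrMr // mulrC ler_pdivlMr // mulrC -natrM ler_nat.
  have xp : x <= pi / 2 by rewrite xE ler_wpM2l ?pi_ge0.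
  have xs : x / 2 <= sin x by apply: half_le_sin; rewrite x0.
  have xn : n%:R / q%:R <= x / 2.
    rewrite xE; have : 0 <= n%:R / q%:R :> R by rewrite divr_ge0.
    nra.
  rewrite -[leRHS]invrK lef_pV2 ?posrE; first last.
  - by rewrite invr_gt0 mulr_gt0 ?divr_gt0 ?invr_gt0.
  - rewrite mulr_gt0 // normr_gt0 gt_eqF //; apply: lt_le_trans xs.
    by apply: lt_le_trans xn; rewrite divr_gt0.
  rewrite invfM invrK invf_div mulrC mulrA [_ * 2]mulrC -mulrA ler_pM2l // mulrC.
  by apply: le_trans (ler_norm _); apply: le_trans xs; rewrite mulrC.
move=> /andP[m0 mq]; rewrite mulrDr.
have ge0 n : 0 <= q%:R / 2 * n%:R^-1 :> R by rewrite mulr_ge0 ?divr_ge0 ?invr_ge0.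
have [mh|mh] := leqP (2 * m) q.
  by apply: ler_wpDr => //; exact: H.
apply: ler_wpDl => //.
have -> : inv_chord R q m = (2 * `|sin (pi - pi * (m%:R / q%:R))|)^-1.
  by rewrite sinB sinpi cospi mul0r sub0r mulN1r opprK.
apply: H; rewrite ?subn_gt0 //; first by lia.
rewrite natrB ?(ltnW mq) // mulrBl divff ?mulrBr ?mulr1 //.
by rewrite pnatr_eq0; lia.
Qed.

(** * Sawtooth sums and their average over the slope *)

Lemma sum_periodic_mul (V : nmodType) n d q (f : nat -> V) :
  n = (d * q)%N -> (forall m, f (m %% q)%N = f m) ->
  \sum_(k < n) f k = (\sum_(k < q) f k) *+ d.
Proof.
move=> -> fq; elim: d => [|d IH]; first by rewrite big_ord0.
rewrite mulSn big_split_ord /= mulrS -IH; congr (_ + _).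
by apply: eq_bigr => i _; rewrite -fq modnDl fq.
Qed.

Lemma sum_periodic_coprime (V : nmodType) q t k (f : nat -> V) :
  (0 < q)%N -> coprime k q -> (forall m, f (m %% q)%N = f m) ->
  \sum_(b < q) f (t + k * b)%N = \sum_(b < q) f b.
Proof.
case: q => // q _ kq fq.
pose h (b : 'I_q.+1) : 'I_q.+1 := inord ((t + k * b) %% q.+1).
have hE b : h b = ((t + k * b) %% q.+1)%N :> nat.
  by rewrite inordK // ltn_pmod.
have hI : injective h.
  move=> b b' /(congr1 (@nat_of_ord _)); rewrite !hE => /eqP.
  rewrite eqn_modDl => e; apply: val_inj => /=.
  wlog bb : b b' e / (b <= b')%N.
    move=> W; have [bb|/ltnW bb] := leqP b b'; first exact: W.
    by rewrite (W b' b) // eq_sym.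
  move: e; rewrite eq_sym eqn_mod_dvd ?leq_mul2l ?bb ?orbT //.
  rewrite -mulnBr Gauss_dvdr 1?coprime_sym // => /dvdnP [c cE].
  have := ltn_ord b'; case: c cE => [|c] cE; first by lia.
  move=> ?; have : (q.+1 <= c.+1 * q.+1)%N by rewrite leq_pmull.
  lia.
rewrite [RHS](reindex_inj hI) /=.
by apply: eq_bigr => b _; rewrite hE fq.
Qed.

Lemma sum_inv_chord_le (R : realType) q : \sum_(h < q) inv_chord R q h <= q%:R * A R q.
Proof.
case: q => [|q]; first by rewrite big_ord0 mul0r.
have c0 : inv_chord R q.+1 0 = 0 by rewrite /inv_chord mul0r mulr0 sin0 normr0 mulr0 invr0.
have Aq : \sum_(i < q) (i.+1)%:R^-1 <= A R q.+1.
  rewrite /A big_add1 /= big_mkord big_ord_recr /=.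
  by rewrite lerDl invr_ge0.
rewrite big_ord_recl c0 add0r.
apply: le_trans (_ : q.+1%:R / 2 * (\sum_(i < q) ((i.+1)%:R^-1 + (q - i)%:R^-1)) <= _).
  rewrite mulr_sumr; apply: ler_sum => i _.
  rewrite lift0; have := @inv_chord_le R q.+1 i.+1; rewrite subSS.
  by apply; have := ltn_ord i; lia.
have E : \sum_(i < q) (q - i)%:R^-1 = \sum_(i < q) i.+1%:R^-1 :> R.
  rewrite (reindex_inj rev_ord_inj) /=; apply: eq_bigr => i _.
  by rewrite subKn.
rewrite big_split /= E -mulrA ler_wpM2l //.
by move: (\sum_(i < q) i.+1%:R^-1) (A R q.+1) Aq => s a ?; lra.
Qed.

(** With d = gcd (k, q), the products k b meet each multiple of d modulo q exactly
    d times, and the chord of d j modulo q is the chord of j modulo q / d. The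
    multiplicity d is compensated by the shorter sum. *)
Lemma sum_inv_chord_mul_le (R : realType) q k : (0 < q)%N ->
  \sum_(b < q) inv_chord R q (k * b) <= q%:R * A R q.
Proof.
move=> q0; set d := gcdn k q.
have d0 : (0 < d)%N by rewrite gcdn_gt0 q0 orbT.
have [k' kE] : exists k', k = (d * k')%N by exists (k %/ d)%N; rewrite mulnC divnK ?dvdn_gcdl.
have [q' qE] : exists q', q = (d * q')%N by exists (q %/ d)%N; rewrite mulnC divnK ?dvdn_gcdr.
have q'0 : (0 < q')%N by move: q0; rewrite qE muln_gt0 => /andP[].
have co : coprime k' q'.
  by rewrite /coprime -(eqn_pmul2l d0) muln1 muln_gcdr -kE -qE.
have -> : \sum_(b < q) inv_chord R q (k * b) = (\sum_(b < q') inv_chord R q' b) *+ d.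
  have E (b : nat) : inv_chord R q (k * b) = inv_chord R q' (k' * b).
    by rewrite -[in RHS](inv_chord_mulr R _ _ d0) mulnA -kE -qE.
  under eq_bigr => b _ do rewrite E.
  rewrite (@sum_periodic_mul _ q d q' (fun b => inv_chord R q' (k' * b))) //.
    by rewrite (@sum_periodic_coprime _ q' 0 k' (inv_chord R q')) // => m; rewrite inv_chord_mod.
  by move=> m; rewrite -inv_chord_mod // modnMmr inv_chord_mod.
rewrite -[X in X <= _]mulr_natl {1}qE natrM -mulrA ler_wpM2l //.
apply: le_trans (sum_inv_chord_le R q') _; rewrite ler_wpM2l //.
have q'q : (q' <= q)%N by rewrite qE leq_pmull.
rewrite /A (big_cat_nat _ (_ : (q'.+1 <= q.+1)%N)) //= lerDl.
by apply: sumr_ge0 => i _; rewrite invr_ge0.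
Qed.

(** A bound for the part of a sawtooth sum of slope r / q that does not come from a
    common factor of r and q. It is large when r / q is close to a fraction with small
    denominator. *)
Definition saw_err (R : realType) (q r : nat) : R :=
  2 / q%:R * \sum_(h < q) inv_chord R q h * inv_chord R q (h * r).

Lemma saw_err_ge0 (R : realType) q r : 0 <= saw_err R q r.
Proof.
by rewrite mulr_ge0 ?divr_ge0 // sumr_ge0 // => h _; rewrite mulr_ge0 ?inv_chord_ge0.
Qed.

(** The progression runs gcd (r, q) times through the residues that are congruent
    to t modulo gcd (r, q). *)
Lemma sum_residues q t r : (0 < q)%N ->
  (2 * \sum_(k < q) ((t + r * k) %% q) + q * gcdn r q =
   q * q + 2 * q * (t %% gcdn r q))%N.
Proof.
move=> q0; set d := gcdn r q.
have d0 : (0 < d)%N by rewrite gcdn_gt0 q0 orbT.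
have [r' rE] : exists r', r = (d * r')%N by exists (r %/ d)%N; rewrite mulnC divnK ?dvdn_gcdl.
have [q' qE] : exists q', q = (d * q')%N by exists (q %/ d)%N; rewrite mulnC divnK ?dvdn_gcdr.
have q'0 : (0 < q')%N by move: q0; rewrite qE muln_gt0 => /andP[].
have co : coprime r' q'.
  by rewrite /coprime -(eqn_pmul2l d0) muln1 muln_gcdr -rE -qE.
have E k : ((t + r * k) %% q = d * ((t %/ d + r' * k) %% q') + t %% d)%N.
  rewrite {1}(divn_eq t d) rE qE -mulnA addnAC [(t %/ d * d)%N]mulnC -mulnDr.
  rewrite -modnDml -muln_modr modn_small //.
  have := ltn_pmod t d0; have := ltn_pmod (t %/ d + r' * k) q'0.
  move: (_ %% q')%N (_ %% d)%N d0 => x y d0 xq yd.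
  have : (d * x.+1 <= d * q')%N by rewrite leq_mul2l xq orbT.
  by rewrite mulnS; apply: leq_trans; rewrite addnC ltn_add2r.
have Q : (2 * \sum_(k < q') k + q' = q' * q')%N.
  elim: (q') => [|n IH]; first by rewrite big_ord0.
  rewrite big_ord_recr /=; move: (\sum_(k < n) _)%N IH => s IH; nia.
have -> : (\sum_(k < q) ((t + r * k) %% q) =
    d * (d * (\sum_(k < q') k)) + q * (t %% d))%N.
  under eq_bigr => k _ do rewrite E.
  rewrite big_split /= sum_nat_const card_ord -big_distrr /=; congr (d * _ + _)%N.
  rewrite (@sum_periodic_mul nat q d q' (fun k => (t %/ d + r' * k) %% q')%N) //.
    rewrite (@sum_periodic_coprime nat q' (t %/ d) r' (fun k => k %% q')%N) //.
      rewrite -mulr_natl natn; congr (_ * _)%R; apply: eq_bigr => i _; exact: modn_small.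
    by move=> m; rewrite modn_mod.
  by move=> m; rewrite -modnDmr modnMmr modnDmr.
rewrite [in (q * q)%N]qE mulnACA -Q qE; move: (t %% d)%N (\sum_(k < q') k)%N.
by move: (d) => e x s; lia.
Qed.

(** Both sides of the Fourier bound are real, only the root of unity is not: f
    embeds the field of the values into the field that contains w. *)
Lemma sawtooth_fourier_real (R C : numFieldType) (f : {rmorphism R -> C}) q
    (w : C) (c : nat -> R) t r K :
  (forall x, `|f x| = f `|x|) -> (forall x y, f x <= f y -> x <= y) ->
  q.-primitive_root w -> `|w| = 1 ->
  (forall m, `|w ^+ m - 1|^-1 = f (c m)) ->
  `|\sum_(k < K) ((t + r * k) %% q)%:R
     - K%:R / q%:R * \sum_(k < q) ((t + r * k) %% q)%:R|
  <= 2 * \sum_(h < q) (c h * c (h * r)%N).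
Proof.
move=> fn fle pw nw cE; apply: fle.
have := sawtooth_fourier t r K pw nw.
under [X in _ <= _ * X]eq_bigr => h _ do rewrite !cE -rmorphM.
have toC n : f (\sum_(k < n) ((t + r * k) %% q)%:R) =
    \sum_(k < n) ((t + r * k) %% q)%:R.
  by rewrite rmorph_sum; apply: eq_bigr => k _; rewrite rmorph_nat.
by rewrite -fn rmorphB !rmorphM !toC fmorphV !rmorph_nat rmorph_sum.
Qed.

(** Over a full period the mean of the terms is 1 / 2 up to gcd (r, q) / q, by
    [sum_residues]; [saw_err] bounds the deviation from this mean. *)
Lemma sawtooth_sum (R : realType) q t r K : (0 < q)%N ->
  `|\sum_(k < K) ((t + r * k) %% q)%:R / q%:R - K%:R / 2|
  <= K%:R * (gcdn r q)%:R / q%:R + saw_err R q r.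
Proof.
move=> q0; have qR : 0 < q%:R :> R by rewrite ltr0n.
pose S K := \sum_(k < K) ((t + r * k) %% q)%:R : R.
have SE K' : \sum_(k < K') ((t + r * k) %% q)%:R / q%:R = S K' / q%:R.
  by rewrite -mulr_suml.
have F1 : `|S K - K%:R / q%:R * S q| <= q%:R * saw_err R q r.
  have fn (x : R) : `|real_complex R x| = real_complex R `|x|.
    by rewrite normc_def /= expr0n addr0 sqrtr_sqr.
  have fle (x y : R) : real_complex R x <= real_complex R y -> x <= y.
    by rewrite lecR.
  have := sawtooth_fourier_real t r K fn fle (unit_root_primitive R q0)
    (norm_unit_root R q) (inv_norm_unit_rootX_sub1 R q).
  move=> /le_trans; apply.
  by rewrite /saw_err !mulrA [q%:R * 2]mulrC mulfK ?gt_eqF.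
have F2 : `|S q - q%:R ^+ 2 / 2| <= q%:R * (gcdn r q)%:R / 2.
  have /(congr1 (fun n => n%:R : R)) := sum_residues t r q0.
  rewrite !natrD !natrM natr_sum -/(S q).
  have : (t %% gcdn r q)%:R <= (gcdn r q)%:R :> R.
    by rewrite ler_nat ltnW // ltn_pmod // gcdn_gt0 q0 orbT.
  have : 0 <= (t %% gcdn r q)%:R :> R by [].
  move: (S q) (_ %% _)%:R (gcdn r q)%:R => s x d x0 xd E.
  have -> : s = (q%:R * q%:R + 2 * q%:R * x - q%:R * d) / 2 by lra.
  have -> : (q%:R * q%:R + 2 * q%:R * x - q%:R * d) / 2 - q%:R ^+ 2 / 2 =
     q%:R * (x - d / 2) by field.
  by rewrite normrM gtr0_norm // -mulrA ler_wpM2l ?(ltW qR) // ler_norml; apply/andP; split; lra.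
have q_neq0 : q%:R != 0 :> R by rewrite gt_eqF.
rewrite SE -(ler_pM2l qR) -{1}[q%:R]gtr0_norm // -normrM.
rewrite (_ : q%:R * (S K / q%:R - K%:R / 2) =
   (S K - K%:R / q%:R * S q) + K%:R / q%:R * (S q - q%:R ^+ 2 / 2)); last by field.
rewrite [X in _ <= X](_ : _ = q%:R * saw_err R q r + K%:R * (gcdn r q)%:R);
  last by field.
apply: le_trans (ler_normD _ _) _; rewrite lerD //.
rewrite normrM ger0_norm ?divr_ge0 //.
apply: le_trans (ler_wpM2l _ F2) _; first by rewrite divr_ge0.
rewrite (_ : _ * (_ * _ / 2) = K%:R * (gcdn r q)%:R / 2); last by field.
by have : 0 <= K%:R * (gcdn r q)%:R :> R by []; lra.
Qed.

(** Over a full period of b, the double sum that defines [saw_err] splits into two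
    sums of reciprocal chords, each at most q A(q). For a single slope the error
    may have the order of the length of the sum; on average it is only O(A(N)^2). *)
Lemma sum_saw_err (R : realType) q i N : (0 < q <= N)%N ->
  \sum_(1 <= b < N.+1) saw_err R q (b * i) <= 4 * N%:R * A R N ^+ 2.
Proof.
move=> /andP[q0 qN]; have qR : 0 < q%:R :> R by rewrite ltr0n.
have A0 n : 0 <= A R n by apply: sumr_ge0 => k _; rewrite invr_ge0.
have AqN : A R q <= A R N.
  rewrite [in leRHS]/A (big_cat_nat _ (_ : (q.+1 <= N.+1)%N)) //= lerDl.
  by apply: sumr_ge0 => k _; rewrite invr_ge0.
have per m : saw_err R q ((m %% q) * i) = saw_err R q (m * i).
  rewrite /saw_err; congr (_ * _); apply: eq_bigr => h _; congr (_ * _).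
  by rewrite -inv_chord_mod // mulnCA modnMml mulnCA inv_chord_mod.
have full : \sum_(b < q) saw_err R q (b * i) <= 2 * q%:R * A R q ^+ 2.
  rewrite -mulr_sumr exchange_big /=.
  under eq_bigr => h _ do rewrite -mulr_sumr.
  apply: le_trans (_ : 2 / q%:R * (\sum_(h < q) inv_chord R q h * (q%:R * A R q)) <= _).
    rewrite ler_wpM2l ?divr_ge0 //; apply: ler_sum => h _.
    rewrite ler_wpM2l ?inv_chord_ge0 //.
    under eq_bigr => b _ do rewrite [(b * i)%N]mulnC mulnA.
    exact: sum_inv_chord_mul_le.
  rewrite -mulr_suml.
  apply: le_trans (_ : 2 / q%:R * (q%:R * A R q * (q%:R * A R q)) <= _).
    by rewrite ler_wpM2l ?divr_ge0 // ler_wpM2r ?mulr_ge0 // sum_inv_chord_le.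
  rewrite le_eqVlt; apply/orP; left; apply/eqP; field.
  by rewrite gt_eqF.
apply: le_trans (_ : \sum_(b < (N %/ q).+1 * q) saw_err R q (b * i) <= _).
  have NN : (N.+1 <= (N %/ q).+1 * q)%N by rewrite ltn_ceil.
  rewrite -(big_mkord xpredT (fun b => saw_err R q (b * i))).
  rewrite (big_cat_nat _ NN) //= [X in _ <= X + _]big_nat_recl //=.
  rewrite big_add1 /= -addrA addrCA lerDl addr_ge0 ?saw_err_ge0 //.
  by apply: sumr_ge0 => b _; exact: saw_err_ge0.
rewrite (@sum_periodic_mul _ _ (N %/ q).+1 q (fun b => saw_err R q (b * i))) //.
rewrite -[X in X <= _]mulr_natl.
apply: le_trans (ler_wpM2l _ full) _; first by [].
have Nq : (N %/ q).+1%:R * q%:R <= 2 * N%:R :> R.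
  by rewrite -!natrM ler_nat; have := leq_trunc_div N q; lia.
rewrite (_ : _ * (2 * _ * _) = 2 * ((N %/ q).+1%:R * q%:R) * A R q ^+ 2); last by ring.
apply: le_trans (_ : 2 * (2 * N%:R) * A R q ^+ 2 <= _).
  by rewrite ler_wpM2r ?exprn_ge0 // ler_wpM2l.
rewrite (_ : 2 * (2 * N%:R) = 4 * N%:R); last by ring.
by rewrite ler_wpM2l ?mulr_ge0 // lerXn2r ?nnegrE.
Qed.

(** * Residue classes and modular inverses *)

Lemma sum_residue_class (V : nmodType) q r n (f : nat -> V) : (r < q)%N ->
  \sum_(u < n | (u %% q == r)%N) f u = \sum_(k < (n + q - 1 - r) %/ q) f (r + q * k)%N.
Proof.
move=> rq; have q0 : (0 < q)%N by exact: leq_ltn_trans rq.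
elim: n => [|n IH]; first by rewrite big_ord0 divn_small ?big_ord0 //; lia.
rewrite big_mkcond big_ord_recr -big_mkcond /= {}IH.
have -> : (n.+1 + q - 1 - r = (n + q - 1 - r).+1)%N by lia.
rewrite divnS //.
have -> : ((n + q - 1 - r).+1 = n + q - r)%N by lia.
have -> : (q %| n + q - r)%N = (n %% q == r)%N.
  rewrite -[in RHS](modnDr n q) -[X in (_ == X)%N](modn_small rq).
  by rewrite eqn_mod_dvd // (leq_trans (ltnW rq)) // leq_addl.
case: eqP => [nr|_]; rewrite ?addr0 //= add1n big_ord_recr /=; congr (_ + f _).
have -> : ((n + q - 1 - r) %/ q = n %/ q)%N.
  rewrite {1}(divn_eq n q) nr.
  have -> : (n %/ q * q + r + q - 1 - r = n %/ q * q + (q - 1))%N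
    by move: (_ * q)%N => x; lia.
  by rewrite divnMDl // [((q - 1) %/ q)%N]divn_small ?addn0 //; lia.
by rewrite mulnC -nr addnC -divn_eq.
Qed.

Lemma count_residue_class q r n : (r < q)%N ->
  (\sum_(u < n) (u %% q == r) = (n + q - 1 - r) %/ q)%N.
Proof.
move=> rq; rewrite -big_mkcond /=.
by rewrite (@sum_residue_class nat q r n (fun=> 1%N)) // sum_nat_const card_ord muln1.
Qed.

Lemma count_multiples c n s z : (0 < c)%N ->
  (\sum_(t < n) (s + c * t == z) =
   [&& s <= z, c %| z - s & z - s < c * n])%N.
Proof.
move=> c0; have [/and3P[sz /dvdnP[k kE] lt]|] := boolP [&& _, _ & _].
  have kn : (k < n)%N by rewrite -(ltn_pmul2l c0) mulnC -kE.
  rewrite (bigD1 (Ordinal kn)) //= big1 ?addn0; first by apply/eqP; rewrite eqb1; lia.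
  move=> t tk; apply/eqP; rewrite eqb0; apply: contra tk => /eqP e.
  apply/eqP/val_inj/eqP; rewrite /= -(eqn_pmul2l c0); lia.
move=> H; rewrite big1 // => t _; apply/eqP; rewrite eqb0; apply: contra H => /eqP <-.
by rewrite leq_addr addKn dvdn_mulr // ltn_pmul2l //=.
Qed.

Lemma eqn_mod_coprime b q m n : (0 < q)%N -> coprime b q ->
  (b * m == b * n %[mod q])%N = (m == n %[mod q])%N.
Proof.
move=> q0 bq; wlog nm : m n / (n <= m)%N.
  by move=> W; have [/W//|/ltnW/W] := leqP n m; rewrite eq_sym => ->; rewrite eq_sym.
by rewrite !eqn_mod_dvd ?leq_mul2l ?nm ?orbT // -mulnBr Gauss_dvdr // coprime_sym.
Qed.

(** A Bezout coefficient, which is an inverse of p when p and q are coprime. *)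
Definition inv_mod (p q : nat) : nat := (egcdn p q).1.

(** A natural number opposite to the inverse: a progression that decreases by b / p
    in Z / q increases by b times this number. *)
Definition opp_inv_mod (p q : nat) : nat := (inv_mod p q * (q - 1))%N.

Lemma inv_modP p q m : (0 < p)%N -> (0 < q)%N -> coprime p q ->
  (p * (inv_mod p q * m) = m %[mod q])%N.
Proof.
move=> p0 q0 /eqP pq; rewrite /inv_mod; case: egcdnP => //= k k' E _.
by rewrite mulnA [(p * k)%N]mulnC E pq mulnDl mul1n mulnAC modnMDl.
Qed.

Lemma coprime_inv_mod p q : (0 < p)%N -> coprime p q -> coprime (inv_mod p q) q.
Proof.
move=> p0 /eqP pq; rewrite /inv_mod; case: egcdnP => //= k k' E _.
rewrite /coprime -dvdn1 -pq -(dvdn_addr _ (dvdn_mull k' (dvdn_gcdr k q))) -E.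
by rewrite dvdn_mulr // dvdn_gcdl.
Qed.

Lemma coprime_opp_inv_mod p q :
  (0 < p)%N -> (0 < q)%N -> coprime p q -> coprime (opp_inv_mod p q) q.
Proof.
move=> p0 q0 pq; rewrite coprimeMl coprime_inv_mod //=.
by rewrite coprime_sym -{1}(subnK q0) addn1 coprimeSn.
Qed.

(** * Cutting a section of the cube into lines *)

(** The coordinates are shifted: u, v and t in [0, 2 L] stand for y_i + L, so that
    the solutions in the cube |y_i| <= L are counted with natural numbers only. *)
Definition plane_count (a b c L : nat) : nat :=
  (\sum_(v < (2 * L).+1) \sum_(u < (2 * L).+1) \sum_(t < (2 * L).+1)
    (a * u + b * v + c * t == (a + b + c) * L))%N.

(** The points of the square for which the third coordinate of the plane is an
    integer, of whatever size. *)
Definition square_count (a b c L : nat) : nat :=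
  (\sum_(v < (2 * L).+1) \sum_(u < (2 * L).+1)
    (a * u + b * v == (a + b) * L %[mod c]))%N.

(** The points of [square_count] where the third coordinate exceeds L. *)
Definition triangle_count (a b c L : nat) : nat :=
  (\sum_(v < (2 * L).+1) \sum_(u < (2 * L).+1)
    ((a * u + b * v + c * L < (a + b) * L) &&
     (a * u + b * v == (a + b) * L %[mod c])))%N.

(** The points whose third coordinate leaves [- L, L] on the two sides correspond
    under y -> - y, whence the factor 2. *)
Lemma square_count_split a b c L : (0 < c)%N ->
  square_count a b c L = (plane_count a b c L + 2 * triangle_count a b c L)%N.
Proof.
move=> c0; rewrite mul2n -addnn addnA.
have rv (i : 'I_(2 * L).+1) : rev_ord i = (2 * L - i)%N :> nat by rewrite /= subSS.
have refl : (triangle_count a b c L = \sum_(v < (2 * L).+1) \sum_(u < (2 * L).+1)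
    (((a + b) * L + c * L < a * u + b * v) &&
     (a * u + b * v == (a + b) * L %[mod c])))%N.
  rewrite /triangle_count (reindex_inj rev_ord_inj) /=; apply: eq_bigr => v _.
  rewrite (reindex_inj rev_ord_inj) /=; apply: eq_bigr => u _; rewrite !subSS.
  have uL : (u <= 2 * L)%N by rewrite -ltnS.
  have vL : (v <= 2 * L)%N by rewrite -ltnS.
  have E : (a * (2 * L - u) + b * (2 * L - v) + (a * u + b * v) =
      (a + b) * L + (a + b) * L)%N.
    by rewrite addnACA -!mulnDr (subnK uL) (subnK vL); lia.
  congr (nat_of_bool (_ && _)).
    by move: (a * (_ - _) + _)%N (a * u + _)%N ((a + b) * L)%N (c * L)%N E; lia.
  move: (a * (_ - _) + _)%N (a * u + _)%N ((a + b) * L)%N E => x y z E.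
  by rewrite -(eqn_modDr y) E eqn_modDl eq_sym.
rewrite {2}refl /square_count /plane_count /triangle_count -!big_split /=; apply: eq_bigr => v _.
rewrite -!big_split /=; apply: eq_bigr => u _.
rewrite count_multiples //.
have -> : ((a + b + c) * L = (a + b) * L + c * L)%N by lia.
move: (a * u + b * v)%N ((a + b) * L)%N => s z.
have divE : (s <= z + c * L)%N -> (c %| z + c * L - s)%N = (s == z %[mod c])%N.
  by move=> sz; rewrite -eqn_mod_dvd // mulnC addnC modnMDl eq_sym.
have [mcong|] := boolP (s == z %[mod c])%N; last first.
  move=> /negbTE ncong; rewrite !andbF.
  by have [sz|//] := leqP s (z + c * L); rewrite divE // ncong.
rewrite !andbT; have [sz|zs] := leqP s (z + c * L); last by rewrite /= ltnNge; lia.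
rewrite divE // mcong /=.
have [zs|sz'] := leqP z (s + c * L).
  by rewrite addn0 addn0; apply/eqP; rewrite eq_sym eqb1 mulnS mulnCA; lia.
have /dvdnP[k kE] : (c %| z + c * L - s)%N by rewrite divE.
have kL : (2 * L < k)%N by rewrite -(ltn_pmul2l c0) [(c * k)%N]mulnC -kE; lia.
by rewrite /= kE mulnC ltn_pmul2l // ltnNge kL.
Qed.

(** Write L = g l + r with r < g. The lines r + g k with k <= 2 l are all those
    below 2 L + 1. *)
Lemma sum_lines (V : nmodType) g L (f : nat -> V) : (0 < g)%N ->
  (forall v, (v %% g != L %% g)%N -> f v = 0) ->
  \sum_(v < (2 * L).+1) f v = \sum_(k < (2 * (L %/ g)).+1) f (L %% g + g * k)%N.
Proof.
move=> g0 f0; rewrite (bigID (fun v : 'I__ => (v %% g == L %% g)%N)) /=.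
rewrite [X in _ + X]big1 ?addr0; last by move=> v; exact: f0.
rewrite (@sum_residue_class V g (L %% g) _ f) ?ltn_pmod //.
have -> // : (((2 * L).+1 + g - 1 - L %% g) %/ g = (2 * (L %/ g)).+1)%N.
rewrite {1}(divn_eq L g); have := ltn_pmod L g0.
move: (L %/ g)%N (L %% g)%N => l v vg.
have -> : ((2 * (l * g + v)).+1 + g - 1 - v = (2 * l).+1 * g + v)%N by lia.
by rewrite divnMDl // divn_small // addn0.
Qed.

(** Only the lines v = L modulo g carry lattice points, since g divides the other
    two coefficients and is coprime to b. *)
Lemma line_mod g p q b L u v : (0 < g)%N -> coprime b g ->
  (g * p * u + b * v == (g * p + b) * L %[mod g * q])%N -> (v %% g == L %% g)%N.
Proof.
move=> g0 bg /eqP/(congr1 (fun m => m %% g)%N).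
rewrite !modn_dvdm ?dvdn_mulr // mulnDl -!mulnA ![(g * _)%N]mulnC !modnMDl.
by move=> /eqP; rewrite eqn_mod_coprime.
Qed.

Lemma line_congr g p q b L u k : (0 < g)%N ->
  (g * p * u + b * (L %% g + g * k) == (g * p + b) * L %[mod g * q])%N =
  (p * u + b * k == p * L + b * (L %/ g) %[mod q])%N.
Proof.
move=> g0.
have -> : (g * p * u + b * (L %% g + g * k) = b * (L %% g) + g * (p * u + b * k))%N.
  by ring.
have -> : ((g * p + b) * L = b * (L %% g) + g * (p * L + b * (L %/ g)))%N.
  by have := divn_eq L g; move: (L %/ g)%N (L %% g)%N => x y ->; ring.
by rewrite eqn_modDl -!muln_modr eqn_pmul2l.
Qed.

Lemma solve_congr p q m u : (0 < p)%N -> (0 < q)%N -> coprime p q ->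
  (p * u == m %[mod q])%N = (u %% q == (inv_mod p q * m) %% q)%N.
Proof. by move=> p0 q0 pq; rewrite -{1}(inv_modP m p0 q0 pq) eqn_mod_coprime. Qed.

Lemma line_residue p q m b u k : (0 < p)%N -> (0 < q)%N -> coprime p q ->
  (p * u + b * k == m %[mod q])%N =
  (u %% q == (inv_mod p q * m + b * opp_inv_mod p q * k) %% q)%N.
Proof.
move=> p0 q0 pq.
have -> : (b * opp_inv_mod p q * k = inv_mod p q * ((q - 1) * (b * k)))%N.
  by rewrite /opp_inv_mod; ring.
rewrite -mulnDr -solve_congr // -[RHS](eqn_modDr (b * k)).
have -> : (m + (q - 1) * (b * k) + b * k = b * k * q + m)%N.
  by case: (q) q0 => // n _; rewrite subn1 /=; ring.
by rewrite modnMDl.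
Qed.

Lemma square_count_lines g p q b L :
  (0 < g)%N -> (0 < p)%N -> (0 < q)%N -> coprime p q -> coprime b g ->
  let r k := ((inv_mod p q * (p * L + b * (L %/ g)) + b * opp_inv_mod p q * k) %% q)%N in
  square_count (g * p) b (g * q) L =
    (\sum_(k < (2 * (L %/ g)).+1) (((2 * L).+1 + q - 1 - r k) %/ q))%N.
Proof.
move=> g0 p0 q0 pq bg r; rewrite /square_count.
rewrite (sum_lines g0 (f := fun v => \sum_(u < (2 * L).+1)
   (g * p * u + b * v == (g * p + b) * L %[mod g * q]))%N) => [|v vL]; last first.
  rewrite big1 // => u _; apply/eqP; rewrite eqb0; apply: contra vL.
  exact: line_mod.
apply: eq_bigr => k _; rewrite -count_residue_class ?ltn_pmod //.
by apply: eq_bigr => u _; rewrite line_congr // line_residue.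
Qed.

(** Popoviciu's count of the solutions of p u + q w = m with u >= 0 and w >= 1.
    The admissible u are r + q s, where r is a residue modulo q, and p u < m
    amounts to (s + 1) p <= W. The number W also makes sense when no u is
    admissible, so that case needs no separate formula. *)
Lemma popoviciu p q m n : (0 < p)%N -> (0 < q)%N -> coprime p q ->
  (0 < m <= p * n)%N ->
  exists W, [/\ (\sum_(u < n) ((p * u < m) && (p * u == m %[mod q])) = W %/ p)%N,
    (q * W + p * ((inv_mod p q * m) %% q) = m + q * (p - 1))%N &
    (W %% p = (inv_mod q p * m + (p - 1)) %% p)%N].
Proof.
move=> p0 q0 pq /andP[m0 mn]; set r := ((_ * _) %% q)%N.
have rq : (r < q)%N by rewrite ltn_pmod.
have pr : (p * r == m %[mod q])%N by rewrite solve_congr // modn_mod.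
have rle : (p * r < m + q * p)%N.
  have : (p * r <= q * p)%N by rewrite mulnC leq_mul2r ltnW ?orbT.
  by lia.
have : (q %| m + q * p - p * r)%N.
  rewrite -eqn_mod_dvd ?(ltnW rle) // addnC [(q * p)%N]mulnC modnMDl eq_sym.
  exact: pr.
move=> /dvdnP[[|W] WE]; first by lia.
have E : (q * W + p * r = m + q * (p - 1))%N.
  have qp : (q * p = q * (p - 1) + q)%N by rewrite -mulnSr subn1 prednK.
  move: WE rle; rewrite qp mulSn [(W * q)%N]mulnC.
  move: (q * W)%N (q * (p - 1))%N (p * r)%N.
  by move=> x y z; lia.
exists W; split=> //; last first.
  apply/eqP; rewrite -(eqn_mod_coprime (b := q)) // 1?coprime_sym // mulnDr.
  by rewrite -modnDml inv_modP // 1?coprime_sym // modnDml -E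
    [(q * W + _)%N]addnC [(p * r)%N]mulnC modnMDl.
have cnt w N : (w <= N -> \sum_(s < N) (s < w) = w)%N.
  have cnt_min n' : (\sum_(s < n') (s < w) = minn w n')%N.
    by elim: n' => [|n' IH]; rewrite ?big_ord0 ?minn0 // big_ord_recr /= IH; lia.
  by move=> /minn_idPl wN; rewrite cnt_min.
have WN : (W %/ p <= (n + q - 1 - r) %/ q)%N.
  rewrite leq_divRL //; have := leq_trunc_div W p; move: (W %/ p)%N => [|w] wW.
    by rewrite mul0n.
  have : (q * (w.+1 * p) <= q * W)%N by rewrite leq_mul2l wW orbT.
  have -> : (q * (w.+1 * p) = p * (q * w) + q * p)%N by ring.
  have qp : (q * p = q * (p - 1) + q)%N by rewrite -mulnSr subn1 prednK.
  move=> H; have : (p * (r + q * w) < p * n)%N.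
    rewrite mulnDr; move: H E mn; rewrite qp.
    move: (q * W)%N (q * (p - 1))%N (p * r)%N (p * (q * w))%N (p * n)%N.
    by move=> x y z t u; lia.
  rewrite ltn_pmul2l // mulSn [(w * q)%N]mulnC; move: (q * w)%N => x.
  by clear -q0; lia.
transitivity (\sum_(u < n | (u %% q == r)%N) (p * u < m))%N.
  rewrite [RHS]big_mkcond /=; apply: eq_bigr => u _.
  by rewrite solve_congr //; case: eqP; rewrite ?andbT ?andbF.
rewrite (@sum_residue_class nat q r n (fun u => (p * u < m)%N)) // -[RHS](cnt _ _ WN).
apply: eq_bigr => s _; congr nat_of_bool.
rewrite leq_divRL // -(ltn_add2r (q * (p - 1))) -E.
have -> : (p * (r + q * s) + q * (p - 1) = q * (p * s + (p - 1)) + p * r)%N.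
  by move: (p - 1)%N => p'; ring.
rewrite ltn_add2r ltn_pmul2l // mulSn [(s * p)%N]mulnC; move: (p * s)%N => x.
by rewrite -addnS subn1 prednK // addnC.
Qed.

(** The line number k cuts the triangle in Popoviciu's problem for n - b k, where n
    is the size of the triangle divided by g; it is empty as soon as b k >= n. *)
Lemma triangle_count_lines g p q b L :
  (0 < g)%N -> (0 < p <= q)%N -> (0 < b <= g * q)%N -> coprime p q -> coprime b g ->
  let n := (p * L + b * (L %/ g) - q * L)%N in
  triangle_count (g * p) b (g * q) L =
    (\sum_(k < (n + b - 1) %/ b) \sum_(u < (2 * L).+1)
       ((p * u < n - b * k) && (p * u == n - b * k %[mod q])))%N.
Proof.
move=> g0 /andP[p0 pq'] /andP[b0 bgq] pq bg n; rewrite /triangle_count.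
rewrite (sum_lines g0 (f := fun v => \sum_(u < (2 * L).+1)
   ((g * p * u + b * v + g * q * L < (g * p + b) * L) &&
    (g * p * u + b * v == (g * p + b) * L %[mod g * q])))%N) => [|v vL]; last first.
  rewrite big1 // => u _; apply/eqP; rewrite eqb0; apply: contra vL.
  by move=> /andP[_]; exact: line_mod.
set l := (L %/ g)%N in n *.
have bl : (b * l <= q * L)%N.
  rewrite (leq_trans (leq_mul bgq (leqnn l))) // -mulnA mulnCA leq_mul2l mulnC.
  by rewrite leq_trunc_div orbT.
have nl : (n <= b * l)%N.
  by rewrite leq_subLR leq_add2r leq_mul2r pq' orbT.
have Kl : ((n + b - 1) %/ b <= (2 * l).+1)%N.
  rewrite -ltnS ltn_divLR //; nia.
have E k u : ((g * p * u + b * (L %% g + g * k) + g * q * L < (g * p + b) * L) &&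
    (g * p * u + b * (L %% g + g * k) == (g * p + b) * L %[mod g * q]))%N =
    ((p * u < n - b * k) && (p * u == n - b * k %[mod q]))%N.
  rewrite line_congr //.
  have -> : (g * p * u + b * (L %% g + g * k) + g * q * L =
     b * (L %% g) + g * (p * u + b * k + q * L))%N by ring.
  have -> : ((g * p + b) * L = b * (L %% g) + g * (p * L + b * l))%N.
    by rewrite /l; have := divn_eq L g; move: (L %/ g)%N (L %% g)%N => x y ->; ring.
  rewrite ltn_add2l ltn_pmul2l //.
  have -> : (p * u + b * k + q * L < p * L + b * l)%N = (p * u < n - b * k)%N.
    by rewrite /n !ltn_subRL; congr (_ < _)%N; ring.
  have [lt|//] := boolP (p * u < n - b * k)%N; rewrite !andTb.
  rewrite -(eqn_modDr (b * k) (p * u)) subnK; last by lia.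
  have -> : (p * L + b * l = L * q + n)%N by rewrite /n; lia.
  by rewrite modnMDl.
rewrite (big_ord_widen_cond _ xpredT (fun k => \sum_(u < (2 * L).+1)
  ((p * u < n - b * k) && (p * u == n - b * k %[mod q])))%N Kl).
rewrite [RHS]big_mkcond /=; apply: eq_bigr => k _.
case: ltnP => [_|kK]; first by apply: eq_bigr => u _; rewrite E.
rewrite big1 // => u _; rewrite E.
have -> : (n - b * k = 0)%N.
  apply/eqP; rewrite subn_eq0; have := ltn_ceil (n + b - 1) b0; nia.
by rewrite ltn0.
Qed.

(** * Square and triangle up to sawtooth sums *)

Lemma natr_divn (R : numFieldType) m d : (0 < d)%N ->
  (m %/ d)%:R = m%:R / d%:R - (m %% d)%:R / d%:R :> R.
Proof.
move=> d0; rewrite {2}(divn_eq m d) natrD natrM mulrDl mulfK ?addrK //.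
by rewrite pnatr_eq0 -lt0n.
Qed.

(** There are about n / g lines, and this spacing g is what turns gcd (b, q) / q into
    the ratio gcd (b, c) / c for the full coefficient c = g q. *)
Lemma ler_gcd_ratio (R : realFieldType) g q b k n :
  (0 < g)%N -> (0 < q)%N -> (g * k <= n)%N ->
  k%:R * (gcdn b q)%:R / q%:R <= n%:R * (gcdn b (g * q))%:R / (g * q)%:R :> R.
Proof.
move=> g0 q0 kn; rewrite ler_pdivrMr ?ltr0n // mulrAC ler_pdivlMr ?ltr0n ?muln_gt0 ?g0 //.
rewrite -!natrM ler_nat mulnACA [(_ * q)%N in leqRHS]mulnC -mulnA.
have : (gcdn b q <= gcdn b (g * q))%N.
  rewrite dvdn_leq ?gcdn_gt0 ?muln_gt0 ?g0 ?q0 ?orbT //.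
  by rewrite dvdn_gcd dvdn_gcdl (dvdn_trans (dvdn_gcdr _ _)) // dvdn_mull.
move: (gcdn _ _) (gcdn _ _) => x y xy.
have := leq_mul (leq_mul kn xy) (leqnn q); lia.
Qed.

Lemma gcdn_mul_coprime b i q : coprime i q -> gcdn (b * i) q = gcdn b q.
Proof. by move=> iq; rewrite gcdnC Gauss_gcdl 1?coprime_sym // gcdnC. Qed.

(** On every line the count is (2 L + q - r) / q rounded down, where r is the residue
    of the line. Both r and the remainder of this division form arithmetic
    progressions in Z / q, of opposite slopes. *)
Lemma square_count_bound (R : realType) g p q b L :
  (0 < g)%N -> (0 < p)%N -> (0 < q)%N -> coprime p q -> coprime b g ->
  `|(square_count (g * p) b (g * q) L)%:R - 4 * L%:R ^+ 2 / (g * q)%:R|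
  <= L%:R * (2 / q%:R + 4 * (gcdn b (g * q))%:R / (g * q)%:R) + 2
     + saw_err R q (b * inv_mod p q) + saw_err R q (b * opp_inv_mod p q).
Proof.
move=> g0 p0 q0 pq bg.
have qR : q%:R != 0 :> R by rewrite pnatr_eq0 -lt0n.
have gR : g%:R != 0 :> R by rewrite pnatr_eq0 -lt0n.
rewrite square_count_lines //; set t := (inv_mod p q * _)%N; set K := (2 * _).+1.
set r := (b * opp_inv_mod p q)%N; set s := (b * inv_mod p q)%N.
have term k : (((2 * L).+1 + q - 1 - (t + r * k) %% q) %/ q)%:R =
   (2 * L%:R) / q%:R + 1 - ((t + r * k) %% q)%:R / q%:R -
   ((2 * L + t * (q - 1) + s * k) %% q)%:R / q%:R :> R.
  rewrite natr_divn //; have := ltn_pmod (t + r * k) q0.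
  set x := ((t + r * k) %% q)%N => xq.
  have -> : (((2 * L).+1 + q - 1 - x) %% q = (2 * L + t * (q - 1) + s * k) %% q)%N.
    apply/eqP; rewrite -(eqn_modDr x) subnK; last by lia.
    rewrite modnDmr.
    have -> : (2 * L + t * (q - 1) + s * k + (t + r * k) =
        2 * L + (t + b * inv_mod p q * k) * q)%N.
      rewrite /r /s /opp_inv_mod; case: (q) q0 => // q' _; rewrite subn1 /=.
      by move: (inv_mod p _) (t) => i t'; ring.
    have -> : ((2 * L).+1 + q - 1 = 2 * L + 1 * q)%N by lia.
    by rewrite ![(2 * L + _)%N]addnC !modnMDl.
  rewrite natrB; last by lia.
  have -> : ((2 * L).+1 + q - 1 = 2 * L + q)%N by lia.
  by rewrite natrD natrM; field.
rewrite natr_sum; under eq_bigr => k _ do rewrite term.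
rewrite !big_split /= !sumrN sumr_const card_ord.
have S1 := sawtooth_sum R t r K q0.
have S2 := sawtooth_sum R (2 * L + t * (q - 1)) s K q0.
rewrite !gcdn_mul_coprime ?coprime_inv_mod ?coprime_opp_inv_mod // in S1 S2.
move: S1 S2; set A1 := \sum_(k < K) _; set A2 := \sum_(k < K) _.
have Kg : (g * (2 * (L %/ g)) <= 2 * L)%N.
  by have := leq_trunc_div L g; lia.
have G1 := @ler_gcd_ratio R g q b _ _ g0 q0 Kg.
have G2 : (gcdn b q)%:R / q%:R <= 1 :> R.
  by rewrite ler_pdivrMr ?ltr0n // mul1r ler_nat dvdn_leq // dvdn_gcdr.
have KG : K%:R * (gcdn b q)%:R / q%:R <=
    2 * (L%:R * (gcdn b (g * q))%:R / (g * q)%:R) + 1 :> R.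
  rewrite /K -[_.+1%:R]natr1 mulrDl mul1r mulrDl lerD //.
  by apply: le_trans G1 _; rewrite natrM !mulrA.
have main : `|K%:R * (2 * L%:R / q%:R) - 4 * L%:R ^+ 2 / (g * q)%:R| <=
    2 * L%:R / q%:R :> R.
  rewrite natrM (_ : _ - _ = 2 * L%:R / q%:R * (K%:R - 2 * L%:R / g%:R)); last first.
    by field; rewrite gR qR.
  rewrite normrM ger0_norm ?divr_ge0 ?mulr_ge0 // -[leRHS]mulr1.
  rewrite ler_wpM2l ?divr_ge0 ?mulr_ge0 //.
  have g0R : 0 < g%:R :> R by rewrite ltr0n.
  rewrite (_ : _ - _ = (K%:R * g%:R - 2 * L%:R) / g%:R); last by field.
  rewrite normrM normfV (gtr0_norm g0R) ler_pdivrMr // mul1r.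
  have LE := divn_eq L g; have vg := ltn_pmod L g0.
  have K1 : K%:R * g%:R <= 2 * L%:R + g%:R :> R.
    by rewrite -!natrM -natrD ler_nat /K; lia.
  have K2 : 2 * L%:R <= K%:R * g%:R + g%:R :> R.
    by rewrite -!natrM -natrD ler_nat /K; lia.
  by rewrite ler_norml; apply/andP; split; lra.
move=> S1 S2.
rewrite -[_ *+ K]mulr_natl sumr_const card_ord.
rewrite [X in _ <= X](_ : _ = 2 * L%:R / q%:R +
  (2 * (2 * (L%:R * (gcdn b (g * q))%:R / (g * q)%:R)) + 2) +
  (saw_err R q s + saw_err R q r)); last by field; rewrite gR qR.
move: main KG S1 S2; rewrite -[1 *+ K]/(K%:R).
set x1 := 4 * _ / _; set x2 := 2 * L%:R / q%:R; set x3 := _ * _ / (g * q)%:R.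
set x4 := _ / q%:R; set s1 := saw_err _ _ _; set s2 := saw_err _ _ _.
set k := K%:R; clearbody x1 x2 x3 x4 s1 s2 k A1 A2.
rewrite !ler_norml => /andP[? ?] ? /andP[? ?] /andP[? ?].
by apply/andP; split; lra.
Qed.

Lemma popoviciu_real (R : realFieldType) p q m n : (0 < p)%N -> (0 < q)%N ->
  coprime p q -> (0 < m <= p * n)%N ->
  (\sum_(u < n) ((p * u < m) && (p * u == m %[mod q])))%N%:R =
  m%:R / (p * q)%:R - ((inv_mod p q * m) %% q)%:R / q%:R + 1 - p%:R^-1
  - ((inv_mod q p * m + (p - 1)) %% p)%:R / p%:R :> R.
Proof.
move=> p0 q0 pq mn; have [W [-> E <-]] := popoviciu p0 q0 pq mn.
have qR : q%:R != 0 :> R by rewrite pnatr_eq0 -lt0n.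
have pR : p%:R != 0 :> R by rewrite pnatr_eq0 -lt0n.
rewrite natr_divn //; congr (_ - _).
have /(congr1 (fun n => n%:R : R)) := E.
rewrite !natrD !natrM natrB //; move: (_ %% q)%:R => r ER.
have -> : m%:R = q%:R * W%:R + p%:R * r - q%:R * (p%:R - 1) :> R by rewrite ER addrK.
by field; rewrite pR qR.
Qed.

(** A Riemann sum of the decreasing function n - b k on its positive part. *)
Lemma sum_arith_bound (R : realFieldType) n b : (0 < b)%N ->
  `|\sum_(k < (n + b - 1) %/ b) (n - b * k)%:R - n%:R ^+ 2 / (2 * b%:R)| <= n%:R :> R.
Proof.
move=> b0; have bR : 0 < b%:R :> R by rewrite ltr0n.
set K := (_ %/ _)%N.
have K1 : (n <= b * K)%N.
  by have := ltn_ceil (n + b - 1) b0; rewrite -/K mulSn mulnC; lia.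
have K2 : (b * K <= n + b - 1)%N by rewrite mulnC leq_trunc_div.
have S K' : (b * K' <= n + b - 1)%N -> \sum_(k < K') (n - b * k)%:R =
    K'%:R * n%:R - b%:R * K'%:R * (K'%:R - 1) / 2 :> R.
  elim: K' => [_|K' IH h]; first by rewrite big_ord0; field.
  rewrite big_ord_recr /= IH; last by move: h; rewrite mulnS; lia.
  rewrite natrB; last by move: h; rewrite mulnS; lia.
  by rewrite natrM -[K'.+1%:R]natr1; field.
rewrite S // {S}.
have K1R : n%:R <= b%:R * K%:R :> R by rewrite -natrM ler_nat.
have K2R : K = 0 \/ b%:R * K%:R <= n%:R + b%:R :> R.
  by right; rewrite -natrM -natrD ler_nat; lia.
have n0 : 0 <= n%:R :> R by [].
have KK : b%:R * (b%:R * K%:R - n%:R) * (n%:R + b%:R - b%:R * K%:R) <=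
    b%:R * (b%:R * n%:R) :> R.
  have [K0|K0] := posnP K.
    have n0' : n = 0%N by move: K1; rewrite K0; lia.
    by rewrite K0 n0' !mulr0 subr0 !mulr0 !mul0r.
  have K3R : b%:R <= b%:R * K%:R :> R by rewrite -natrM ler_nat leq_pmulr.
  rewrite -mulrA ler_wpM2l ?(ltW bR) //.
  case: K2R => [K20|K2R]; first by rewrite K20 in K0.
  apply: ler_pM; lra.
rewrite (_ : _ - _ = (b%:R * n%:R + (b%:R * K%:R - n%:R) *
   (n%:R + b%:R - b%:R * K%:R)) / (2 * b%:R)); last by field; rewrite gt_eqF.
case: K2R => [K20|K2R].
  have n0' : n = 0%N by move: K1; rewrite K20; lia.
  by rewrite K20 n0' !mulr0 subrr mul0r addr0 mul0r normr0.
rewrite ger0_norm; last first.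
  rewrite divr_ge0 ?mulr_ge0 ?addr_ge0 //; last by rewrite mulr_ge0 //; lra.
rewrite ler_pdivrMr ?mulr_gt0 //.
have {}KK : (b%:R * K%:R - n%:R) * (n%:R + b%:R - b%:R * K%:R) <= b%:R * n%:R :> R.
  by rewrite -(ler_pM2l bR) mulrA.
by lra.
Qed.

(** The number N is the size of the triangle. Its value g n on the first line falls
    short of N by at most b g, the change of size from one line to the next. *)
Lemma triangle_size g p q b L : (0 < g)%N -> (b <= g * q)%N ->
  let N := ((g * p + b - g * q) * L)%N in
  let n := (p * L + b * (L %/ g) - q * L)%N in
  [/\ (N <= g * p * L)%N, (g * n <= N)%N & (N <= g * n + b * g)%N].
Proof.
move=> g0 bgq N n; split.
- by rewrite leq_mul2r leq_subLR addnC leq_add2r bgq orbT.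
- rewrite /N /n mulnBr mulnDr mulnBl mulnDl !mulnA leq_sub2r // leq_add2l.
  by rewrite [(g * b)%N]mulnC -mulnA leq_mul2l mulnC leq_trunc_div orbT.
rewrite /N /n mulnBr mulnDr mulnBl mulnDl !mulnA leq_subLR.
have : (b * L <= g * b * (L %/ g) + b * g)%N.
  rewrite [(g * b)%N]mulnC -mulnA -mulnDr leq_mul2l; apply/orP; right.
  by rewrite addnC -mulnS mulnC ltnW // ltn_ceil.
move: (b * L)%N (g * p * L)%N (g * q * L)%N (g * b * _)%N (b * g)%N.
by clear; lia.
Qed.

(** The linear part of Popoviciu's formula sums to the area. One of its two
    fractional parts moves with a slope modulo q, the other with a slope modulo p;
    the constants cancel against the means 1 / 2 of the two fractional parts. *)
Lemma triangle_count_bound (R : realType) g p q b L :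
  (0 < g)%N -> (0 < p <= q)%N -> (0 < b <= g * q)%N -> coprime p q -> coprime b g ->
  `|(triangle_count (g * p) b (g * q) L)%:R -
    ((g * p + b - g * q) * L)%:R ^+ 2 / (2 * (g * p * b * (g * q))%:R)|
  <= L%:R * (2 / q%:R + (gcdn b (g * q))%:R / (g * q)%:R
                      + 2 * (gcdn b (g * p))%:R / (g * p)%:R)
     + saw_err R q (b * opp_inv_mod p q) + saw_err R p (b * opp_inv_mod q p).
Proof.
move=> g0 pq' bgq pq bg.
have [p0 pleq] := andP pq'; have q0 := leq_trans p0 pleq.
have [b0 bleq] := andP bgq.
have qR : 0 < q%:R :> R by rewrite ltr0n.
have pR : 0 < p%:R :> R by rewrite ltr0n.
have gR : 0 < g%:R :> R by rewrite ltr0n.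
have bR : 0 < b%:R :> R by rewrite ltr0n.
have qp : coprime q p by rewrite coprime_sym.
rewrite triangle_count_lines //; set l := (L %/ g)%N; set n := (p * L + _ - _)%N; set K := ((n + b - 1) %/ b)%N.
have gl : (g * l <= L)%N by rewrite mulnC leq_trunc_div.
have bl : (b * l <= q * L)%N.
  rewrite (leq_trans (leq_mul bleq (leqnn l))) // -mulnA mulnCA.
  by rewrite leq_mul2l gl orbT.
have npL : (n <= p * L)%N by rewrite /n; lia.
have nbl : (n <= b * l)%N by rewrite leq_subLR leq_add2r leq_mul2r pleq orbT.
have Kn k : (k < K)%N -> (b * k < n)%N.
  move=> kK; have := leq_trunc_div (n + b - 1) b; rewrite -/K.
  have : (b * k.+1 <= K * b)%N by rewrite mulnC leq_mul2r kK orbT.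
  by rewrite mulnS; lia.
have Kl : (K <= l)%N.
  rewrite leqNgt; apply/negP => /Kn; lia.
have Kg : (g * K <= L)%N by rewrite (leq_trans _ gl) // leq_mul2l Kl orbT.
pose t1 := (inv_mod p q * n)%N; pose r1 := (b * opp_inv_mod p q)%N.
pose t2 := (inv_mod q p * n + (p - 1))%N; pose r2 := (b * opp_inv_mod q p)%N.
have shift x y k : (0 < y)%N -> (b * k < n)%N ->
    (inv_mod x y * (n - b * k) = inv_mod x y * n + b * opp_inv_mod x y * k %[mod y])%N.
  move=> y0 kn; apply/eqP; rewrite -(eqn_modDr (inv_mod x y * (b * k))) -mulnDr.
  rewrite subnK ?(ltnW kn) // -addnA.
  have -> : (b * opp_inv_mod x y * k + inv_mod x y * (b * k) = inv_mod x y * b * k * y)%N.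
    rewrite /opp_inv_mod; case: y y0 => // y _; rewrite subn1 /=.
    by move: (inv_mod _ _) => i; ring.
  by rewrite addnC modnMDl.
have term (k : 'I_K) : (\sum_(u < (2 * L).+1)
       ((p * u < n - b * k) && (p * u == n - b * k %[mod q])))%N%:R =
    (n - b * k)%:R / (p * q)%:R - ((t1 + r1 * k) %% q)%:R / q%:R + (1 - p%:R^-1)
     - ((t2 + r2 * k) %% p)%:R / p%:R :> R.
  have kn := Kn k (ltn_ord k).
  rewrite popoviciu_real //; last first.
    rewrite subn_gt0 kn /= (leq_trans (leq_subr _ _)) // (leq_trans npL) //.
    by rewrite leq_mul2l; apply/orP; right; lia.
  rewrite addrA; congr (_ - _%:R / _ + _ - _ - _%:R / _); first exact: shift.
  by rewrite -modnDml shift // modnDml /t2 addnAC.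
rewrite natr_sum; under eq_bigr => k _ do rewrite term.
rewrite !big_split /= !sumrN sumr_const card_ord -mulr_suml.
have S1 := sawtooth_sum R t1 r1 K q0.
have S2 := sawtooth_sum R t2 r2 K p0.
have S3 := sum_arith_bound R n b0; rewrite -/K in S3.
rewrite !gcdn_mul_coprime ?coprime_opp_inv_mod // in S1 S2.
have G1 := @ler_gcd_ratio R g q b _ _ g0 q0 Kg.
have G2 := @ler_gcd_ratio R g p b _ _ g0 p0 Kg.
have G3 : K%:R / p%:R <= L%:R * (gcdn b (g * p))%:R / (g * p)%:R :> R.
  apply: le_trans G2; rewrite -mulrA ler_wpM2l // ler_pdivlMr // mulVf ?gt_eqF //.
  by rewrite (ler_nat R 1) gcdn_gt0 b0.
set N := ((g * p + b - g * q) * L)%N.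
have [NL Nn1 Nn2] : [/\ N%:R <= g%:R * p%:R * L%:R :> R, g%:R * n%:R <= N%:R :> R &
    N%:R <= g%:R * n%:R + b%:R * g%:R :> R].
  have /= [] := triangle_size p L g0 bleq; rewrite -/n -/N.
  by clearbody N; rewrite -!(ler_nat R) natrD !natrM.
clearbody N.
have main : `|(\sum_(k < K) (n - b * k)%:R) / (p * q)%:R -
    N%:R ^+ 2 / (2 * (g * p * b * (g * q))%:R)| <= 2 * L%:R / q%:R :> R.
  have -> : (\sum_(k < K) (n - b * k)%:R) / (p * q)%:R -
    N%:R ^+ 2 / (2 * (g * p * b * (g * q))%:R) =
    (\sum_(k < K) (n - b * k)%:R - n%:R ^+ 2 / (2 * b%:R)) / (p * q)%:R -
    ((N%:R - g%:R * n%:R) * (N%:R + g%:R * n%:R)) / (2 * (g * p * b * (g * q))%:R) :> R.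
    by rewrite !natrM; field; rewrite !gt_eqF.
  apply: le_trans (ler_normB _ _) _.
  rewrite (_ : 2 * L%:R / q%:R = L%:R / q%:R + L%:R / q%:R); last by ring.
  apply: lerD.
    rewrite normrM normfV normr_nat ler_pdivrMr ?ltr0n ?muln_gt0 ?p0 //.
    apply: le_trans S3 _; rewrite natrM mulrCA divfK ?gt_eqF //.
    by rewrite -natrM ler_nat.
  have n0 : 0 <= n%:R :> R by [].
  have L0 : 0 <= L%:R :> R by [].
  rewrite ger0_norm; last first.
    apply: divr_ge0; last by rewrite mulr_ge0.
    apply: mulr_ge0; first by rewrite subr_ge0.
    by rewrite addr_ge0 // mulr_ge0.
  rewrite ler_pdivrMr ?mulr_gt0 ?ltr0n ?muln_gt0 ?g0 ?p0 ?b0 ?q0 //.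
  apply: le_trans (_ : (b%:R * g%:R) * (2 * (g%:R * p%:R * L%:R)) <= _).
    apply: ler_pM; first by rewrite subr_ge0.
    - by rewrite addr_ge0 // mulr_ge0.
    - by rewrite lerBlDl.
    - by rewrite mulr2n mulrDl mul1r lerD // (le_trans Nn1).
  rewrite !natrM le_eqVlt; apply/orP; left; apply/eqP; field.
  by rewrite gt_eqF.
rewrite [X in _ <= X](_ : _ = 2 * L%:R / q%:R +
  (L%:R * (gcdn b (g * q))%:R / (g * q)%:R) +
  2 * (L%:R * (gcdn b (g * p))%:R / (g * p)%:R) +
  (saw_err R q r1 + saw_err R p r2)); last first.
  by field; rewrite !gt_eqF.
have G4 : 0 <= K%:R / p%:R :> R by rewrite divr_ge0.
move: main G1 G2 G3 G4 S1 S2.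
rewrite sumr_const card_ord -[p%:R^-1 *+ K]mulr_natl.
set x1 := _ / (2 * _); set x2 := 2 * L%:R / q%:R; set x3 := _ * _ / (g * q)%:R.
set x4 := _ * _ / (g * p)%:R; set x5 := _ / q%:R; set x6 := _ * (gcdn _ _)%:R / p%:R.
set s1 := saw_err _ _ _; set s2 := saw_err _ _ _; set x7 := K%:R / p%:R.
set y := _ / (p * q)%:R; set A1 := \sum_(k < K) _; set A2 := \sum_(k < K) _.
clearbody x1 x2 x3 x4 x5 x6 s1 s2 x7 A1 A2 y.
set k := K%:R : R; clearbody k.
rewrite !ler_norml => /andP[? ?] ? ? ? ? /andP[? ?] /andP[? ?].
by apply/andP; split; lra.
Qed.

(** * The number of solutions for a primitive vector *)

(** The area of the section of the cube |y_i| <= 1 by the plane, divided by the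
    Euclidean length of (a, b, c). Projected along the axis of the largest
    coefficient m, the section is a square of area 4 without two triangles; they
    are empty when the other two coefficients add up to at most m, and then the
    truncated subtraction gives 0. *)
Definition density (R : realFieldType) (a b c : nat) : R :=
  let m := maxn a (maxn b c) in
  4 / m%:R - (a + b + c - 2 * m)%:R ^+ 2 / (a * b * c)%:R.

(** The sum of the error terms of the square and of the triangle, for a, b <= c and
    up to constant factors. *)
Definition plane_err (R : realType) (a b c L : nat) : R :=
  let p := (a %/ gcdn a c)%N in let q := (c %/ gcdn a c)%N in
  L%:R * ((gcdn a c)%:R / c%:R + (gcdn b c)%:R / c%:R + (gcdn b a)%:R / a%:R) + 1
  + saw_err R q (b * inv_mod p q) + saw_err R q (b * opp_inv_mod p q)
  + saw_err R p (b * opp_inv_mod q p).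

Lemma plane_count_bound (R : realType) a b c L :
  (0 < a <= c)%N -> (0 < b <= c)%N -> coprime b (gcdn a c) ->
  `|(plane_count a b c L)%:R - L%:R ^+ 2 * density R a b c|
    <= 6 * plane_err R a b c L.
Proof.
move=> /andP[a0 ac] /andP[b0 bc] co.
rewrite /plane_err; set g := gcdn a c in co *.
set p := (a %/ g)%N; set q := (c %/ g)%N => /=.
have g0 : (0 < g)%N by rewrite gcdn_gt0 a0.
have aE : (a = g * p)%N by rewrite mulnC divnK ?dvdn_gcdl.
have cE : (c = g * q)%N by rewrite mulnC divnK ?dvdn_gcdr.
have p0 : (0 < p)%N by move: a0; rewrite aE muln_gt0 => /andP[].
have q0 : (0 < q)%N by move: (leq_trans a0 ac); rewrite cE muln_gt0 => /andP[].
have pq : coprime p q by rewrite /coprime -(eqn_pmul2l g0) muln1 muln_gcdr -aE -cE.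
have pleq : (p <= q)%N by rewrite -(leq_pmul2l g0) -aE -cE.
have c0 := leq_trans a0 ac.
have aR : a%:R != 0 :> R by rewrite pnatr_eq0 -lt0n.
have bR : b%:R != 0 :> R by rewrite pnatr_eq0 -lt0n.
have cR : c%:R != 0 :> R by rewrite pnatr_eq0 -lt0n.
have H1 := @square_count_bound R g p q b L g0 p0 q0 pq co.
have H2 : `|(triangle_count (g * p) b (g * q) L)%:R -
    ((g * p + b - g * q) * L)%:R ^+ 2 / (2 * (g * p * b * (g * q))%:R)|
  <= L%:R * (2 / q%:R + (gcdn b (g * q))%:R / (g * q)%:R
                      + 2 * (gcdn b (g * p))%:R / (g * p)%:R)
     + saw_err R q (b * opp_inv_mod p q) + saw_err R p (b * opp_inv_mod q p).
  by apply: triangle_count_bound; rewrite -?cE ?b0 ?p0.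
have -> : g%:R / c%:R = q%:R^-1 :> R.
  rewrite cE natrM invfM mulrA divff ?mul1r // pnatr_eq0 -lt0n //.
rewrite -aE -cE in H1 H2.
have S := square_count_split a b L c0.
have DE : L%:R ^+ 2 * density R a b c = 4 * L%:R ^+ 2 / c%:R -
    2 * (((a + b - c) * L)%:R ^+ 2 / (2 * (a * b * c)%:R)).
  rewrite /density.
  have -> : maxn a (maxn b c) = c by rewrite (maxn_idPr bc) (maxn_idPr ac).
  have -> : (a + b + c - 2 * c = a + b - c)%N by lia.
  by rewrite !natrM; field; rewrite aR bR cR.
have PE : (plane_count a b c L)%:R =
    (square_count a b c L)%:R - 2 * (triangle_count a b c L)%:R :> R.
  by rewrite S natrD natrM addrK.
rewrite DE PE.
have s1 := saw_err_ge0 R q (b * inv_mod p q).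
have s2 := saw_err_ge0 R q (b * opp_inv_mod p q).
have s3 := saw_err_ge0 R p (b * opp_inv_mod q p).
have x1 : 0 <= L%:R * q%:R^-1 :> R by rewrite divr_ge0.
have x2 : 0 <= L%:R * ((gcdn b c)%:R / c%:R) :> R by rewrite mulr_ge0 ?divr_ge0.
have x3 : 0 <= L%:R * ((gcdn b a)%:R / a%:R) :> R by rewrite mulr_ge0 ?divr_ge0.
rewrite [X in 6 * X](_ : _ = L%:R * q%:R^-1 + L%:R * ((gcdn b c)%:R / c%:R) +
  L%:R * ((gcdn b a)%:R / a%:R) + 1 + saw_err R q (b * inv_mod p q) +
  saw_err R q (b * opp_inv_mod p q) + saw_err R p (b * opp_inv_mod q p)); last by ring.
rewrite [X in _ <= X](_ : _ = 2 * (L%:R * q%:R^-1) +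
  4 * (L%:R * ((gcdn b c)%:R / c%:R)) + 2 + saw_err R q (b * inv_mod p q) +
  saw_err R q (b * opp_inv_mod p q)) in H1; last by ring.
rewrite [X in _ <= X](_ : _ = 2 * (L%:R * q%:R^-1) +
  L%:R * ((gcdn b c)%:R / c%:R) + 2 * (L%:R * ((gcdn b a)%:R / a%:R)) +
  saw_err R q (b * opp_inv_mod p q) + saw_err R p (b * opp_inv_mod q p)) in H2;
  last by ring.
move: s1 s2 s3 x1 x2 x3 H1 H2; clear.
set s1 := saw_err R q (b * inv_mod p q); set s2 := saw_err R q (_ * opp_inv_mod _ _).
set s3 := saw_err R p _; set y1 := L%:R * q%:R^-1; set y2 := L%:R * (_ / c%:R).
set y3 := L%:R * (_ / a%:R); set z1 := _ / c%:R; set z2 := _ / (2 * _).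
move: (square_count _ _ _ _)%:R (triangle_count _ _ _ _)%:R => sq tr.
clearbody s1 s2 s3 y1 y2 y3 z1 z2.
move=> ? ? ? ? ? ?; rewrite !ler_norml => /andP[? ?] /andP[? ?].
by apply/andP; split; lra.
Qed.

Lemma density_swap12 (R : realFieldType) a b c : density R b a c = density R a b c.
Proof. by rewrite /density maxnCA [(b + a)%N]addnC [(b * a)%N]mulnC. Qed.

Lemma density_swap23 (R : realFieldType) a b c : density R a c b = density R a b c.
Proof. by rewrite /density [maxn c b]maxnC addnAC mulnAC. Qed.

(** The solutions of b y_1 + c y_2 = 0 in the square |y_i| <= L, in the shifted
    coordinates of [plane_count]: they are what remains of the solutions for
    (a, b, c) with first coordinate 0. *)
Definition pair_count (b c L : nat) : nat :=
  (\sum_(v < (2 * L).+1) \sum_(t < (2 * L).+1) (b * v + c * t == (b + c) * L))%N.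

Lemma pair_countC b c L : pair_count b c L = pair_count c b L.
Proof.
rewrite /pair_count exchange_big /=; apply: eq_bigr => v _; apply: eq_bigr => t _.
by rewrite addnC [(b + c)%N]addnC.
Qed.

(** The first coordinate is a multiple of c / gcd (b, c), and it determines the
    second. *)
Lemma pair_count_bound (R : realFieldType) b c L : (0 < b)%N -> (0 < c)%N ->
  (pair_count b c L)%:R <= 2 * (L%:R * ((gcdn b c)%:R / c%:R)) + 1 :> R.
Proof.
move=> b0 c0; set g := gcdn b c.
have g0 : (0 < g)%N by rewrite gcdn_gt0 b0.
pose c' := (c %/ g)%N; pose b' := (b %/ g)%N.
have bE : b = (g * b')%N by rewrite mulnC divnK ?dvdn_gcdl.
have cE : c = (g * c')%N by rewrite mulnC divnK ?dvdn_gcdr.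
have c'0 : (0 < c')%N by move: c0; rewrite cE muln_gt0 => /andP[].
have bc : coprime b' c' by rewrite /coprime -(eqn_pmul2l g0) muln1 muln_gcdr -bE -cE.
have le : (pair_count b c L <= (2 * (L %/ c')).+1)%N.
  rewrite /pair_count (sum_lines c'0 (f := fun v =>
     \sum_(t < (2 * L).+1) (b * v + c * t == (b + c) * L))%N) => [|v vL].
    apply: leq_trans (_ : \sum_(k < (2 * (L %/ c')).+1) 1 <= _)%N; last first.
      by rewrite sum_nat_const card_ord muln1.
    by apply: leq_sum => k _; rewrite count_multiples // leq_b1.
  rewrite big1 // => t _; apply/eqP; rewrite eqb0; apply: contra vL => /eqP.
  rewrite bE cE -!mulnA -!mulnDr -mulnA => /eqP; rewrite eqn_pmul2l // mulnDl.
  move=> /eqP/(congr1 (fun m => m %% c')%N).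
  rewrite ![(c' * _)%N]mulnC ![(b' * _ + _)%N]addnC !modnMDl => /eqP.
  by rewrite eqn_mod_coprime.
have c'R : g%:R / c%:R = c'%:R^-1 :> R.
  by rewrite cE natrM invfM mulrA divff ?mul1r // pnatr_eq0 -lt0n.
apply: le_trans (_ : (2 * (L %/ c')).+1%:R <= _); first by rewrite ler_nat.
rewrite -natr1 lerD2r natrM ler_wpM2l // c'R ler_pdivlMr ?ltr0n // -natrM ler_nat.
exact: leq_trunc_div.
Qed.

Definition nonzero_count (a b c L : nat) : nat :=
  (\sum_(u < (2 * L).+1) \sum_(v < (2 * L).+1) \sum_(t < (2 * L).+1)
    [&& (u : nat) != L, (v : nat) != L, (t : nat) != L &
        a * u + b * v + c * t == (a + b + c) * L])%N.

Lemma nonzero_count_swap12 a b c L : nonzero_count b a c L = nonzero_count a b c L.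
Proof.
rewrite /nonzero_count exchange_big /=.
do 3 (apply: eq_bigr => ? _); congr nat_of_bool.
by rewrite andbCA [(b + a)%N]addnC [(b * _ + _)%N]addnC.
Qed.

Lemma nonzero_count_swap23 a b c L : nonzero_count a c b L = nonzero_count a b c L.
Proof.
rewrite /nonzero_count; apply: eq_bigr => u _; rewrite exchange_big /=.
do 2 (apply: eq_bigr => ? _); congr nat_of_bool.
by rewrite [X in _ && X]andbCA addnAC [(a + c + b)%N]addnAC.
Qed.

Lemma sum_ord_pred1 n L (f : nat -> nat) : (L < n)%N ->
  (\sum_(u < n) ((u : nat) == L) * f u)%N = f L.
Proof.
move=> Ln; rewrite (bigD1 (Ordinal Ln)) //= eqxx mul1n big1 ?addn0 // => u uL.
by rewrite (_ : _ == _ = false) //; apply: contra_neqF uL => /eqP uL; exact: val_inj.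
Qed.

Lemma plane_count_nonzero a b c L :
  (nonzero_count a b c L <= plane_count a b c L <= nonzero_count a b c L +
    pair_count b c L + pair_count a c L + pair_count a b L)%N.
Proof.
have L2 : (L < (2 * L).+1)%N by lia.
pose S (P : nat -> nat -> nat -> bool) :=
  (\sum_(u < (2 * L).+1) \sum_(v < (2 * L).+1) \sum_(t < (2 * L).+1) P u v t)%N.
pose e u v t := (a * u + b * v + c * t == (a + b + c) * L)%N.
have plane : plane_count a b c L = S e by rewrite /plane_count exchange_big.
have nz : nonzero_count a b c L =
  S (fun u v t => [&& u != L, v != L, t != L & e u v t]) by [].
have Su : S (fun u v t => (u == L) && e u v t) = pair_count b c L.
  rewrite /S; under eq_bigr => u _.
    under eq_bigr => v _ do (under eq_bigr => t _ do rewrite -mulnb; rewrite -big_distrr /=).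
    rewrite -big_distrr /=; over.
  rewrite (sum_ord_pred1 (fun u => \sum_(v < (2 * L).+1) \sum_(t < (2 * L).+1) e u v t)%N L2).
  do 2 (apply: eq_bigr => ? _); congr nat_of_bool.
  by rewrite /e -!addnA mulnDl eqn_add2l.
have Sv : S (fun u v t => (v == L) && e u v t) = pair_count a c L.
  rewrite /S; apply: eq_bigr => u _; under eq_bigr => v _.
    under eq_bigr => t _ do rewrite -mulnb.
    rewrite -big_distrr /=; over.
  rewrite (sum_ord_pred1 (fun v => \sum_(t < (2 * L).+1) e u v t)%N L2).
  apply: eq_bigr => ? _; congr nat_of_bool.
  by rewrite /e addnAC [(a + b + c)%N]addnAC [((_ + b) * L)%N]mulnDl eqn_add2r.
have St : S (fun u v t => (t == L) && e u v t) = pair_count a b L.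
  rewrite /S; apply: eq_bigr => u _; apply: eq_bigr => v _.
  under eq_bigr => t _ do rewrite -mulnb.
  rewrite (sum_ord_pred1 (fun t => e u v t : nat) L2); congr nat_of_bool.
  by rewrite /e [((_ + c) * L)%N]mulnDl eqn_add2r.
rewrite plane nz -Su -Sv -St /S -!big_split /=; apply/andP; split.
  do 3 (apply: leq_sum => ? _); by case: (e _ _ _); rewrite ?andbT ?andbF // leq_b1.
apply: leq_sum => u _; rewrite -!big_split /=; apply: leq_sum => v _.
rewrite -!big_split /=; apply: leq_sum => t _.
by case: (e _ _ _); rewrite ?andbF // !andbT; case: eqP; case: eqP; case: eqP.
Qed.

Lemma nonzero_count_bound (R : realType) a b c L :
  (0 < a <= c)%N -> (0 < b <= c)%N -> coprime b (gcdn a c) ->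
  `|(nonzero_count a b c L)%:R - L%:R ^+ 2 * density R a b c|
    <= 9 * plane_err R a b c L.
Proof.
move=> ac bc co; have H := plane_count_bound R L ac bc co.
have [[a0 _] [b0 _]] := (andP ac, andP bc).
have c0 : (0 < c)%N by case/andP: ac; exact: leq_trans.
have /andP[N1 N2] := plane_count_nonzero a b c L.
have P1 := pair_count_bound R L b0 c0.
have P2 := pair_count_bound R L a0 c0.
have P3 := pair_count_bound R L b0 a0.
rewrite pair_countC in P3.
rewrite -(ler_nat R) in N1; rewrite -(ler_nat R) !natrD in N2.
move: H; rewrite /plane_err; set p := (a %/ _)%N; set q := (c %/ _)%N => /=.
set d := L%:R ^+ 2 * density R a b c; clearbody d => H.
have s1 := saw_err_ge0 R q (b * inv_mod p q).
have s2 := saw_err_ge0 R q (b * opp_inv_mod p q).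
have s3 := saw_err_ge0 R p (b * opp_inv_mod q p).
have x1 : 0 <= L%:R * ((gcdn a c)%:R / c%:R) :> R by rewrite mulr_ge0 ?divr_ge0.
have x2 : 0 <= L%:R * ((gcdn b c)%:R / c%:R) :> R by rewrite mulr_ge0 ?divr_ge0.
have x3 : 0 <= L%:R * ((gcdn b a)%:R / a%:R) :> R by rewrite mulr_ge0 ?divr_ge0.
rewrite !mulrDr in H *.
move: P1 P2 P3 N1 N2 s1 s2 s3 x1 x2 x3 H; clear.
set x1 := L%:R * ((gcdn a c)%:R / _); set x2 := L%:R * ((gcdn b c)%:R / _).
set x3 := L%:R * ((gcdn b a)%:R / _).
set s1 := saw_err R q (b * inv_mod p q); set s2 := saw_err R q (_ * opp_inv_mod _ _).
set s3 := saw_err R p _; set n := (nonzero_count _ _ _ _)%:R.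
set m := (plane_count _ _ _ _)%:R.
set y1 := (pair_count b c L)%:R; set y2 := (pair_count a c L)%:R.
set y3 := (pair_count a b L)%:R.
clearbody x1 x2 x3 s1 s2 s3 n m y1 y2 y3.
move=> ? ? ? ? ? ? ? ? ? ? ?; rewrite !ler_norml => /andP[? ?].
by apply/andP; split; lra.
Qed.

(** * Summation over the coefficient vectors *)

Lemma sum_multiples (V : nmodType) d n (f : nat -> V) : (0 < d)%N ->
  \sum_(1 <= a < n.+1 | (d %| a)%N) f a = \sum_(1 <= k < (n %/ d).+1) f (d * k)%N.
Proof.
move=> d0; elim: n => [|n IH]; first by rewrite div0n !big_geq.
rewrite big_mkcond big_nat_recr //= -big_mkcond /= IH divnS //.
case: ifPn => [dn|_]; last by rewrite addr0.
rewrite add1n [in RHS]big_nat_recr //=; congr (_ + f _).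
rewrite -[(n %/ d).+1]add1n -[X in (X + _)%N]/(nat_of_bool true) -dn -divnS //.
by rewrite mulnC divnK.
Qed.

Lemma A_ge0 (R : realType) n : 0 <= A R n.
Proof. by apply: sumr_ge0 => k _; rewrite invr_ge0. Qed.

Lemma le_A (R : realType) m n : (m <= n)%N -> A R m <= A R n.
Proof.
move=> mn; rewrite [leRHS](big_cat_nat _ (_ : (m.+1 <= n.+1)%N)) //= lerDl.
by apply: sumr_ge0 => k _; rewrite invr_ge0.
Qed.

Lemma A_ge1 (R : realType) n : (0 < n)%N -> 1 <= A R n.
Proof. by move=> n0; apply: le_trans (le_A R n0); rewrite /A big_nat1 invr1. Qed.

Definition sum3 (V : nmodType) (n : nat) (f : nat -> nat -> nat -> V) : V :=
  \sum_(1 <= a < n.+1) \sum_(1 <= b < n.+1) \sum_(1 <= c < n.+1) f a b c.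

Lemma sum3_swap12 (V : nmodType) n f : @sum3 V n (fun a b c => f b a c) = sum3 n f.
Proof. by rewrite /sum3 exchange_big. Qed.

Lemma sum3_swap23 (V : nmodType) n f : @sum3 V n (fun a b c => f a c b) = sum3 n f.
Proof. by rewrite /sum3; apply: eq_bigr => a _; rewrite exchange_big. Qed.

Lemma sum3D (V : nmodType) n f g :
  @sum3 V n (fun a b c => f a b c + g a b c) = sum3 n f + sum3 n g.
Proof.
rewrite /sum3 -big_split; apply: eq_bigr => a _; rewrite -big_split.
by apply: eq_bigr => b _; rewrite -big_split.
Qed.

Lemma sum3_mulr (R : pzRingType) n (x : R) f :
  sum3 n (fun a b c => x * f a b c) = x * sum3 n f.
Proof.
rewrite /sum3 mulr_sumr; apply: eq_bigr => a _; rewrite mulr_sumr.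
by apply: eq_bigr => b _; rewrite mulr_sumr.
Qed.

Lemma le_sum3 (R : numDomainType) n (f g : nat -> nat -> nat -> R) :
  (forall a b c, (0 < a <= n)%N -> (0 < b <= n)%N -> (0 < c <= n)%N ->
     f a b c <= g a b c) -> sum3 n f <= sum3 n g.
Proof.
move=> fg; rewrite /sum3 big_nat [leRHS]big_nat; apply: ler_sum => a ha.
rewrite big_nat [leRHS]big_nat; apply: ler_sum => b hb.
rewrite big_nat [leRHS]big_nat; apply: ler_sum => c hc.
exact: fg.
Qed.

Lemma eq_sum3 (V : nmodType) n (f g : nat -> nat -> nat -> V) :
  (forall a b c, (0 < a)%N -> (0 < b)%N -> (0 < c)%N ->
     f a b c = g a b c) -> sum3 n f = sum3 n g.
Proof.
move=> fg; rewrite /sum3 big_nat [RHS]big_nat; apply: eq_bigr => a /andP[a0 _].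
rewrite big_nat [RHS]big_nat; apply: eq_bigr => b /andP[b0 _].
rewrite big_nat [RHS]big_nat; apply: eq_bigr => c /andP[c0 _].
exact: fg.
Qed.

Lemma sum3_const (R : pzRingType) n (x : R) : sum3 n (fun _ _ _ => x) = n%:R ^+ 3 * x.
Proof.
by rewrite /sum3 !sumr_const_nat !subn1 /= -!mulrnA -[LHS]mulr_natl !natrM exprS expr2 !mulrA.
Qed.

(** The gcd is one of the common divisors d of a and c, so it is at most their sum.
    For a fixed d there are n / d multiples a, and the multiples c contribute a
    harmonic sum. *)
Lemma sum_gcd_ratio (R : realType) n :
  \sum_(1 <= a < n.+1) \sum_(1 <= c < n.+1) (gcdn a c)%:R / c%:R
  <= n%:R * A R n ^+ 2.
Proof.
pose T d a c : R := if (d %| a)%N && (d %| c)%N then d%:R / c%:R else 0.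
apply: le_trans (_ : \sum_(1 <= a < n.+1) \sum_(1 <= c < n.+1)
    \sum_(1 <= d < n.+1) T d a c <= _).
  rewrite big_nat [leRHS]big_nat; apply: ler_sum => a /andP[a0 an].
  apply: ler_sum => c _.
  have ga : (gcdn a c <= a)%N by rewrite dvdn_leq // dvdn_gcdl.
  rewrite (bigD1_seq (gcdn a c)) /= ?iota_uniq //; last first.
    by rewrite mem_index_iota gcdn_gt0 a0 (leq_ltn_trans ga).
  rewrite {1}/T dvdn_gcdl dvdn_gcdr lerDl sumr_ge0 // => d _.
  by rewrite /T; case: ifP => // _; rewrite divr_ge0.
under eq_bigr => a _ do rewrite exchange_big /=.
rewrite exchange_big /=.
apply: le_trans (_ : \sum_(1 <= d < n.+1) n%:R * A R n * d%:R^-1 <= _); last first.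
  by rewrite -mulr_sumr -/(A R n) -mulrA -expr2.
rewrite big_nat [leRHS]big_nat; apply: ler_sum => d /andP[d0 dn].
have dR : d%:R != 0 :> R by rewrite pnatr_eq0 -lt0n.
have -> : \sum_(1 <= a < n.+1) \sum_(1 <= c < n.+1) T d a c =
    \sum_(1 <= a < n.+1 | (d %| a)%N) \sum_(1 <= c < n.+1 | (d %| c)%N) d%:R / c%:R.
  rewrite [RHS]big_mkcond; apply: eq_bigr => a _; rewrite /T.
  by case: (d %| a)%N => /=; [rewrite [RHS]big_mkcond | rewrite big1].
rewrite sum_multiples // sumr_const_nat subn1 /= sum_multiples //.
have -> : \sum_(1 <= k < (n %/ d).+1) d%:R / (d * k)%:R = A R (n %/ d).
  apply: eq_bigr => k _.
  by rewrite natrM invfM mulrA divff // mul1r.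
rewrite -[leLHS]mulr_natl [leRHS]mulrAC; apply: ler_pM; rewrite ?A_ge0 ?le_A ?leq_div //.
by rewrite ler_pdivlMr ?ltr0n // -natrM ler_nat leq_trunc_div.
Qed.

Lemma plane_err_ge0 (R : realType) a b c L : 0 <= plane_err R a b c L.
Proof.
by rewrite /plane_err !addr_ge0 ?saw_err_ge0 ?mulr_ge0 ?addr_ge0 ?divr_ge0.
Qed.

(** For fixed a and c the slopes in [saw_err] are b times a constant, so
    [sum_saw_err] applies to the sum over b. *)
Lemma sum3_plane_err (R : realType) n L :
  sum3 n (fun a b c => plane_err R a b c L) <=
  13 * ((n%:R ^+ 3 + n%:R ^+ 2 * L%:R) * A R n ^+ 2).
Proof.
have [->|n0] := posnP n.
  by rewrite /sum3 big_geq // !expr0n !mul0r addr0 mul0r mulr0.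
have G := sum_gcd_ratio R n.
have A1 := A_ge1 R n0.
have A2 : 1 <= A R n ^+ 2 by exact: exprn_ege1.
pose q a c := (c %/ gcdn a c)%N; pose p a c := (a %/ gcdn a c)%N.
have qn a c : (0 < c <= n)%N -> (0 < q a c <= n)%N.
  move=> /andP[c0 cn]; rewrite divn_gt0 ?gcdn_gt0 ?c0 ?orbT //.
  by rewrite dvdn_leq ?dvdn_gcdr //= (leq_trans (leq_div _ _)).
have pn a c : (0 < a <= n)%N -> (0 < p a c <= n)%N.
  move=> /andP[c0 cn]; rewrite divn_gt0 ?gcdn_gt0 ?c0 ?orbT //.
  by rewrite dvdn_leq ?dvdn_gcdl //= (leq_trans (leq_div _ _)).
have saw s i : (forall a c, (0 < a <= n)%N -> (0 < c <= n)%N -> (0 < s a c <= n)%N) ->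
    sum3 n (fun a b c => saw_err R (s a c) (b * i a c)) <=
    4 * (n%:R ^+ 3 * A R n ^+ 2).
  move=> sn; rewrite -sum3_swap23 /sum3.
  apply: le_trans (_ : \sum_(1 <= a < n.+1) \sum_(1 <= c < n.+1)
     (4 * n%:R * A R n ^+ 2) <= _).
    rewrite big_nat [leRHS]big_nat; apply: ler_sum => a ha.
    rewrite big_nat [leRHS]big_nat; apply: ler_sum => c hc.
    by apply: sum_saw_err; exact: sn.
  rewrite !sumr_const_nat !subn1 /= -mulrnA -[leLHS]mulr_natl natrM.
  by rewrite le_eqVlt; apply/orP; left; apply/eqP; ring.
have saw1 := saw q (fun a c => inv_mod (p a c) (q a c)) (fun a c _ => qn a c).
have saw2 := saw q (fun a c => opp_inv_mod (p a c) (q a c)) (fun a c _ => qn a c).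
have saw3 := saw p (fun a c => opp_inv_mod (q a c) (p a c)) (fun a c ha _ => pn a c ha).
have n1 : 1 <= n%:R :> R by rewrite (ler_nat R 1).
rewrite (_ : sum3 n _ =
  L%:R * sum3 n (fun a b c => (gcdn a c)%:R / c%:R + (gcdn b c)%:R / c%:R +
                              (gcdn b a)%:R / a%:R) + n%:R ^+ 3
  + sum3 n (fun a b c => saw_err R (q a c) (b * inv_mod (p a c) (q a c)))
  + sum3 n (fun a b c => saw_err R (q a c) (b * opp_inv_mod (p a c) (q a c)))
  + sum3 n (fun a b c => saw_err R (p a c) (b * opp_inv_mod (q a c) (p a c)))); last first.
  by rewrite -sum3_mulr -[X in _ + X + _ + _ + _]mulr1 -sum3_const -!sum3D.
have -> : sum3 n (fun a b c => (gcdn a c)%:R / c%:R + (gcdn b c)%:R / c%:R +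
                              (gcdn b a)%:R / a%:R) =
   3 * (n%:R * \sum_(1 <= a < n.+1) \sum_(1 <= c < n.+1) (gcdn a c)%:R / c%:R) :> R.
  have E : sum3 n (fun a b c => (gcdn b c)%:R / c%:R) =
     n%:R * \sum_(1 <= a < n.+1) \sum_(1 <= c < n.+1) (gcdn a c)%:R / c%:R :> R.
    by rewrite /sum3 sumr_const_nat subn1 mulr_natl.
  rewrite !sum3D E -(sum3_swap12 n (fun a b c => (gcdn a c)%:R / c%:R)) E.
  rewrite -(sum3_swap12 n (fun a b c => (gcdn b a)%:R / a%:R)).
  rewrite -(sum3_swap23 n (fun b a c => (gcdn b a)%:R / a%:R)).
  rewrite -(sum3_swap12 n (fun b c a => (gcdn b a)%:R / a%:R)) E.
  by ring.
have H : L%:R * (3 * (n%:R * (\sum_(1 <= a < n.+1) \sum_(1 <= c < n.+1)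
     (gcdn a c)%:R / c%:R))) <= 3 * (n%:R ^+ 2 * L%:R * A R n ^+ 2).
  rewrite mulrCA ler_pM2l // (_ : n%:R ^+ 2 * L%:R * _ = L%:R * (n%:R * (n%:R * A R n ^+ 2))).
    by rewrite !ler_wpM2l.
  by ring.
have H3 : n%:R ^+ 3 <= n%:R ^+ 3 * A R n ^+ 2 by rewrite ler_peMr // exprn_ge0.
have H4 : 0 <= n%:R ^+ 2 * L%:R * A R n ^+ 2 by rewrite !mulr_ge0 ?exprn_ge0 ?A_ge0.
have -> : 13 * ((n%:R ^+ 3 + n%:R ^+ 2 * L%:R) * A R n ^+ 2) =
  13 * (n%:R ^+ 3 * A R n ^+ 2) + 13 * (n%:R ^+ 2 * L%:R * A R n ^+ 2) by ring.
move: H saw1 saw2 saw3 H3 H4.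
set x1 := n%:R ^+ 3 * _; set x2 := _ * A R n ^+ 2; set x3 := L%:R * _.
set s1 := sum3 n _; set s2 := sum3 n _; set s3 := sum3 n _; set x4 := n%:R ^+ 3.
clearbody x1 x2 x3 s1 s2 s3 x4; clear; move=> *; lra.
Qed.

Definition gcd3 (a b c : nat) : nat := gcdn b (gcdn a c).

(** The count and the density are symmetric, and one of the three coefficients is the
    largest. *)
Lemma nonzero_count_bound_sym (R : realType) a b c L :
  (0 < a)%N -> (0 < b)%N -> (0 < c)%N -> gcd3 a b c = 1%N ->
  `|(nonzero_count a b c L)%:R - L%:R ^+ 2 * density R a b c|
    <= 9 * (plane_err R a b c L + plane_err R a c b L + plane_err R c b a L).
Proof.
move=> a0 b0 c0 co.
have := plane_err_ge0 R a b c L; have := plane_err_ge0 R a c b L.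
have := plane_err_ge0 R c b a L => e1 e2 e3.
have [ac|/ltnW ca] := leqP a c.
  have [bc|/ltnW cb] := leqP b c.
    have := @nonzero_count_bound R a b c L; rewrite a0 ac b0 bc /coprime -/(gcd3 a b c) co.
    by move=> /(_ isT isT isT) h; apply: le_trans h _; lra.
  have ab := leq_trans ac cb.
  have := @nonzero_count_bound R a c b L; rewrite a0 ab c0 cb.
  rewrite /coprime gcdnC -gcdnA [gcdn b c]gcdnC gcdnA gcdnC -/(gcd3 a b c) co.
  rewrite nonzero_count_swap23 density_swap23.
  by move=> /(_ isT isT isT) h; apply: le_trans h _; lra.
have swap : nonzero_count c b a L = nonzero_count a b c L.
  by rewrite nonzero_count_swap12 nonzero_count_swap23 nonzero_count_swap12.
have dswap : density R c b a = density R a b c.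
  by rewrite density_swap12 density_swap23 density_swap12.
have [ab|/ltnW ba] := leqP a b.
  have cb := leq_trans ca ab.
  have := @nonzero_count_bound R a c b L; rewrite a0 ab c0 cb.
  rewrite /coprime gcdnC -gcdnA [gcdn b c]gcdnC gcdnA gcdnC -/(gcd3 a b c) co.
  rewrite nonzero_count_swap23 density_swap23.
  by move=> /(_ isT isT isT) h; apply: le_trans h _; lra.
have := @nonzero_count_bound R c b a L; rewrite c0 ca b0 ba /coprime [gcdn c a]gcdnC.
rewrite -/(gcd3 a b c) co swap dswap.
by move=> /(_ isT isT isT) h; apply: le_trans h _; lra.
Qed.

Lemma nonzero_count_mul h a b c L : (0 < h)%N ->
  nonzero_count (h * a) (h * b) (h * c) L = nonzero_count a b c L.
Proof.
move=> h0; do 3 (apply: eq_bigr => ? _); congr nat_of_bool.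
by rewrite -!mulnA -!mulnDr -mulnA eqn_pmul2l.
Qed.

Lemma density_mul (R : realFieldType) h a b c : (0 < h)%N ->
  h%:R * density R (h * a) (h * b) (h * c) = density R a b c.
Proof.
move=> h0; have hR : h%:R != 0 :> R by rewrite pnatr_eq0 -lt0n.
rewrite /density -!maxnMr -!mulnDr mulnCA -mulnBr.
have -> : (h * a * (h * b) * (h * c) = h * h * h * (a * b * c))%N by ring.
move: (maxn _ _) (_ - _)%N (a * b * c)%N => m s v.
rewrite !natrM !invfM; move: (v%:R^-1) (m%:R^-1) => y z.
by field.
Qed.

(** A vector with gcd h is h times a primitive vector of the box [1, n / h]^3. *)
Lemma sum3_by_gcd (R : numDomainType) n (G : nat -> nat -> nat -> R) :
  (forall a b c, 0 <= G a b c) ->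
  sum3 n (fun a b c => let h := gcd3 a b c in G (a %/ h) (b %/ h) (c %/ h))%N <=
  \sum_(1 <= h < n.+1) sum3 (n %/ h) (fun a b c =>
     if gcd3 a b c == 1%N then G a b c else 0).
Proof.
move=> G0; pose H a b c := if gcd3 a b c == 1%N then G a b c else 0.
have H0 a b c : 0 <= H a b c by rewrite /H; case: ifP.
apply: le_trans (_ : sum3 n (fun a b c => \sum_(1 <= h < n.+1)
   if [&& h %| a, h %| b & h %| c]%N then H (a %/ h)%N (b %/ h)%N (c %/ h)%N else 0) <= _).
  apply: le_sum3 => a b c /andP[a0 _] /andP[b0 bn] /andP[c0 _] /=.
  have g0 : (0 < gcd3 a b c)%N by rewrite gcdn_gt0 b0.
  have gb : (gcd3 a b c <= b)%N by rewrite dvdn_leq // dvdn_gcdl.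
  rewrite (bigD1_seq (gcd3 a b c)) /= ?iota_uniq //; last first.
    by rewrite mem_index_iota g0 (leq_ltn_trans gb).
  have da : (gcd3 a b c %| a)%N := dvdn_trans (dvdn_gcdr _ _) (dvdn_gcdl _ _).
  have db : (gcd3 a b c %| b)%N := dvdn_gcdl _ _.
  have dc : (gcd3 a b c %| c)%N := dvdn_trans (dvdn_gcdr _ _) (dvdn_gcdr _ _).
  rewrite da db dc /= {1}/H.
  have -> : gcd3 (a %/ gcd3 a b c) (b %/ gcd3 a b c) (c %/ gcd3 a b c) = 1%N.
    apply/eqP; rewrite -(eqn_pmul2l g0) muln1 /gcd3 !muln_gcdr -/(gcd3 a b c).
    by rewrite ![(gcd3 a b c * _)%N]mulnC !divnK.
  by rewrite eqxx lerDl sumr_ge0 // => h _; case: ifP.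
rewrite /sum3.
under eq_bigr => a _ do (under eq_bigr => b _ do rewrite exchange_big /=;
  rewrite exchange_big /=).
rewrite exchange_big /= big_nat [leRHS]big_nat; apply: ler_sum => h /andP[h0 _].
rewrite le_eqVlt; apply/orP; left; apply/eqP.
have E (f : nat -> R) : \sum_(1 <= k < (n %/ h).+1) f k =
    \sum_(1 <= a < n.+1) if (h %| a)%N then f (a %/ h)%N else 0.
  rewrite -big_mkcond sum_multiples //; apply: eq_bigr => k _; by rewrite mulKn.
rewrite E; apply: eq_bigr => a _; case: (h %| a)%N; last first.
  by rewrite big1 // => b _; rewrite big1.
rewrite E; apply: eq_bigr => b _; case: (h %| b)%N; last by rewrite big1.
by rewrite E.
Qed.

Lemma sum_sqr_divn (R : realFieldType) n :
  \sum_(1 <= h < n.+1) (n %/ h)%:R ^+ 2 <= 2 * n%:R ^+ 2 :> R.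
Proof.
have S m : \sum_(1 <= h < m.+2) (h%:R ^+ 2)^-1 <= 2 - m.+1%:R^-1 :> R.
  elim: m => [|m IH]; first by rewrite big_nat1 expr1n invr1; lra.
  rewrite big_nat_recr //=; apply: le_trans (lerD IH (lexx _)) _.
  have m0 : 0 < m.+1%:R :> R by rewrite ltr0n.
  rewrite -[m.+2%:R]natr1; move: (m.+1%:R) m0 => x x0.
  have x1 : 0 < x + 1 by lra.
  rewrite -subr_ge0 (_ : _ - _ = (x * (x + 1) ^+ 2)^-1); last first.
    by field; rewrite !gt_eqF.
  by rewrite invr_ge0 mulr_ge0 ?exprn_ge0 ?(ltW x0) ?(ltW x1).
case: n => [|n]; first by rewrite big_geq // mulr_ge0.
apply: le_trans (_ : \sum_(1 <= h < n.+2) n.+1%:R ^+ 2 * (h%:R ^+ 2)^-1 <= _).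
  rewrite big_nat [leRHS]big_nat; apply: ler_sum => h /andP[h0 _].
  rewrite -exprVn -exprMn lerXn2r ?nnegrE ?divr_ge0 //.
  by rewrite ler_pdivlMr ?ltr0n // -natrM ler_nat leq_trunc_div.
rewrite -mulr_sumr mulrC ler_wpM2r ?exprn_ge0 //.
by apply: le_trans (S n) _; rewrite gerBl invr_ge0.
Qed.

(** Both terms of the difference depend only on the primitive vector below (a, b, c).
    The box of the primitive vectors for the gcd h contributes
    O((n / h)^2 (n + L) A(n)^2), and the sum over h converges. *)
Lemma total_count_bound (R : realType) n L :
  sum3 n (fun a b c => `|(nonzero_count a b c L)%:R -
     L%:R ^+ 2 * ((gcd3 a b c)%:R * density R a b c)|)
  <= 702 * ((n%:R ^+ 3 + n%:R ^+ 2 * L%:R) * A R n ^+ 2).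
Proof.
pose G a b c : R := `|(nonzero_count a b c L)%:R - L%:R ^+ 2 * density R a b c|.
have prim m : (m <= n)%N -> sum3 m (fun a b c => if gcd3 a b c == 1%N then G a b c else 0)
    <= 351 * (m%:R ^+ 2 * ((n%:R + L%:R) * A R n ^+ 2)).
  move=> mn; apply: le_trans (_ : sum3 m (fun a b c => 9 * (plane_err R a b c L +
      plane_err R a c b L + plane_err R c b a L)) <= _).
    apply: le_sum3 => a b c /andP[a0 _] /andP[b0 _] /andP[c0 _].
    case: eqP => [co|_]; first exact: nonzero_count_bound_sym.
    apply: mulr_ge0 => //; apply: addr_ge0; last exact: plane_err_ge0.
    by apply: addr_ge0; exact: plane_err_ge0.
  pose P a b c := plane_err R a b c L.
  have E1 : sum3 m (fun a b c => P a c b) = sum3 m P := sum3_swap23 m P.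
  have E2 : sum3 m (fun a b c => P c b a) = sum3 m P.
    rewrite -(sum3_swap12 m P) -(sum3_swap23 m (fun a b c => P b a c)).
    exact: (sum3_swap12 m (fun a b c => P c a b)).
  rewrite sum3_mulr (_ : sum3 m _ = sum3 m P + sum3 m (fun a b c => P a c b) +
    sum3 m (fun a b c => P c b a)); last by rewrite -!sum3D.
  rewrite E1 E2.
  have := sum3_plane_err R m L; rewrite -/P; move: (sum3 m P) => s.
  have : (m%:R ^+ 3 + m%:R ^+ 2 * L%:R) * A R m ^+ 2 <=
      m%:R ^+ 2 * ((n%:R + L%:R) * A R n ^+ 2).
    rewrite (_ : _ * A R m ^+ 2 = m%:R ^+ 2 * ((m%:R + L%:R) * A R m ^+ 2)); last by ring.
    rewrite ler_wpM2l ?exprn_ge0 // ler_pM ?addr_ge0 ?exprn_ge0 ?A_ge0 //.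
      by rewrite lerD2r ler_nat.
    by rewrite lerXn2r ?nnegrE ?A_ge0 // le_A.
  by move=> h1 h2; lra.
rewrite (_ : sum3 n _ = sum3 n (fun a b c => let h := gcd3 a b c in
    G (a %/ h) (b %/ h) (c %/ h))%N); last first.
  apply: eq_sum3 => a b c a0 b0 c0 /=; set h := gcd3 a b c.
  have h0 : (0 < h)%N by rewrite gcdn_gt0 b0.
  have da : (h %| a)%N := dvdn_trans (dvdn_gcdr _ _) (dvdn_gcdl _ _).
  have db : (h %| b)%N := dvdn_gcdl _ _.
  have dc : (h %| c)%N := dvdn_trans (dvdn_gcdr _ _) (dvdn_gcdr _ _).
  rewrite /G -[in RHS](nonzero_count_mul _ _ _ L h0) -[in RHS](density_mul R _ _ _ h0).
  by rewrite ![(h * _)%N]mulnC !divnK.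
apply: le_trans (sum3_by_gcd n (G := G) _) _; first by move=> *; rewrite normr_ge0.
apply: le_trans (_ : \sum_(1 <= h < n.+1)
   351 * ((n %/ h)%:R ^+ 2 * ((n%:R + L%:R) * A R n ^+ 2)) <= _).
  by apply: ler_sum => h _; apply: prim; exact: leq_div.
rewrite -mulr_sumr -mulr_suml.
rewrite (_ : 702 * _ = 351 * (2 * n%:R ^+ 2 * ((n%:R + L%:R) * A R n ^+ 2))); last by ring.
apply: ler_wpM2l; first exact: ler0n.
apply: ler_wpM2r; last exact: sum_sqr_divn.
by rewrite mulr_ge0 ?addr_ge0 ?exprn_ge0 ?A_ge0.
Qed.

(** With m the largest coefficient, a + b + c - 2 m is at most each of the two
    others. *)
Lemma density_bounds (R : realFieldType) a b c : (0 < a)%N -> (0 < b)%N -> (0 < c)%N ->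
  0 <= density R a b c <= 4 / c%:R.
Proof.
move=> a0 b0 c0; rewrite /density; set m := maxn a _.
have m0 : (0 < m)%N by rewrite leq_max a0.
have cm : (c <= m)%N by rewrite !leq_max leqnn !orbT.
have key : ((a + b + c - 2 * m) ^ 2 * m <= a * b * c)%N.
  have sq x y z : (x <= y)%N -> (x <= z)%N -> (x ^ 2 <= y * z)%N.
    by move=> xy xz; rewrite expnS expn1 leq_mul.
  have [ac|/ltnW ca] := leqP a c.
    have [bc|/ltnW cb] := leqP b c.
      have -> : m = c by rewrite /m (maxn_idPr bc) (maxn_idPr ac).
      by rewrite leq_mul // sq //; lia.
    have -> : m = b by rewrite /m (maxn_idPl cb) (maxn_idPr (leq_trans ac cb)).
    by rewrite mulnAC leq_mul // sq //; lia.
  have [ab|/ltnW ba] := leqP a b.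
    have -> : m = b by rewrite /m (maxn_idPl (leq_trans ca ab)) (maxn_idPr ab).
    by rewrite mulnAC leq_mul // sq //; lia.
  have -> : m = a by apply/maxn_idPl; rewrite geq_max ba ca.
  by rewrite mulnC -mulnA leq_mul // sq //; lia.
have mR : 0 < m%:R :> R by rewrite ltr0n.
have vR : 0 < (a * b * c)%:R :> R by rewrite ltr0n !muln_gt0 a0 b0.
apply/andP; split.
  rewrite subr_ge0 ler_pdivrMr // mulrAC ler_pdivlMr // -natrX -!natrM ler_nat.
  by apply: leq_trans key _; rewrite leq_pmull.
apply: le_trans (_ : 4 / m%:R <= _); first by rewrite gerBl divr_ge0 ?exprn_ge0.
by rewrite ler_pM2l // lef_pV2 ?posrE ?ltr0n // ler_nat.
Qed.

Lemma sum3_density (R : realType) n :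
  0 <= sum3 n (fun a b c => (gcd3 a b c)%:R * density R a b c) <=
  4 * (n%:R ^+ 2 * A R n ^+ 2).
Proof.
apply/andP; split.
  rewrite -[leLHS](mulr0 (n%:R ^+ 3)) -sum3_const.
  apply: le_sum3 => a b c /andP[a0 _] /andP[b0 _] /andP[c0 _].
  by rewrite mulr_ge0 //; case/andP: (density_bounds R a0 b0 c0).
apply: le_trans (_ : sum3 n (fun a b c => 4 * ((gcdn b c)%:R / c%:R)) <= _).
  apply: le_sum3 => a b c /andP[a0 _] /andP[b0 _] /andP[c0 _].
  have /andP[d0 d4] := density_bounds R a0 b0 c0.
  rewrite mulrCA; apply: ler_pM => //.
  rewrite ler_nat dvdn_leq ?gcdn_gt0 ?b0 // dvdn_gcd dvdn_gcdl.
  by rewrite (dvdn_trans (dvdn_gcdr _ _)) // dvdn_gcdr.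
rewrite sum3_mulr ler_pM2l // /sum3 sumr_const_nat subn1 /= -[leLHS]mulr_natl.
by rewrite expr2 -mulrA ler_wpM2l // sum_gcd_ratio.
Qed.

(** * Closed form of the sum of the densities *)

Lemma sum3_recr (V : nmodType) n (f : nat -> nat -> nat -> V) :
  (forall a b c, f b a c = f a b c) -> (forall a b c, f a c b = f a b c) ->
  sum3 n.+1 f = sum3 n f
    + (\sum_(1 <= a < n.+1) \sum_(1 <= b < n.+1) f a b n.+1) *+ 3
    + (\sum_(1 <= a < n.+1) f a n.+1 n.+1) *+ 3 + f n.+1 n.+1 n.+1.
Proof.
move=> f12 f23; set m := n.+1.
pose S2 := \sum_(1 <= a < m) \sum_(1 <= b < m) f a b m.
pose S1 := \sum_(1 <= a < m) f a m m.
have T1 : \sum_(1 <= b < m) \sum_(1 <= c < m) f m b c = S2.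
  by apply: eq_bigr => b _; apply: eq_bigr => c _; rewrite f12 f23.
have T2 : \sum_(1 <= b < m) f m b m = S1.
  by apply: eq_bigr => b _; rewrite f12.
have T3 : \sum_(1 <= c < m) f m m c = S1.
  by apply: eq_bigr => c _; rewrite f23 f12.
have inner a b : \sum_(1 <= c < m.+1) f a b c = \sum_(1 <= c < m) f a b c + f a b m.
  by rewrite big_nat_recr.
have mid a : \sum_(1 <= b < m.+1) \sum_(1 <= c < m.+1) f a b c =
    \sum_(1 <= b < m) \sum_(1 <= c < m) f a b c + \sum_(1 <= b < m) f a b m
    + \sum_(1 <= c < m) f a m c + f a m m.
  rewrite big_nat_recr //= inner; under eq_bigr => b _ do rewrite inner.
  by rewrite big_split /= addrA.
rewrite /sum3 big_nat_recr //= mid; under eq_bigr => a _ do rewrite mid.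
rewrite !big_split /= T1 T2 T3 -/S1.
have -> : \sum_(1 <= a < m) \sum_(1 <= c < m) f a m c = S2.
  by apply: eq_bigr => a _; apply: eq_bigr => c _; rewrite f23.
rewrite -/S2 !mulrSr !mulr0n !add0r.
by rewrite !addrA [LHS](ACl (1*2*3*5*4*6*7*8)).
Qed.

(** The sum over the pairs a, b <= n with a + b > n; for these pairs the triangles
    cut off from the square of (a, b, n + 1) have a nonnegative size. *)
Definition corner_sum (R : fieldType) (n : nat) (f : nat -> nat -> R) : R :=
  \sum_(1 <= a < n.+1) \sum_(n.+1 - a <= b < n.+1) f a b.

Lemma corner_sum_sym (R : fieldType) n f :
  @corner_sum R n (fun a b => f b a) = corner_sum n f.
Proof.
have E g : @corner_sum R n g = \sum_(1 <= a < n.+1) \sum_(1 <= b < n.+1)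
    if (n.+1 <= a + b)%N then g a b else 0.
  rewrite /corner_sum big_nat [RHS]big_nat; apply: eq_bigr => a /andP[a0 an].
  rewrite [RHS](big_cat_nat (n := (n.+1 - a)%N)) /=; [|lia|lia].
  rewrite [X in _ = X + _]big_nat [X in _ = X + _]big1 ?add0r; last first.
    by move=> b ?; rewrite ifF //; lia.
  rewrite big_nat [RHS]big_nat; apply: eq_bigr => b ?.
  by rewrite ifT //; lia.
rewrite !E exchange_big /=; apply: eq_bigr => a _; apply: eq_bigr => b _.
by rewrite addnC.
Qed.

Lemma sum_natr (R : numFieldType) k m : (k <= m)%N ->
  \sum_(k <= b < m) b%:R = (m%:R * (m%:R - 1) - k%:R * (k%:R - 1)) / 2 :> R.
Proof.
elim: m => [|m IH]; first by rewrite leqn0 => /eqP->; rewrite big_geq // subrr mul0r.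
rewrite leq_eqVlt => /orP[/eqP->|km]; first by rewrite big_geq // subrr mul0r.
by rewrite big_nat_recr //= IH // -[m.+1%:R]natr1; field.
Qed.

(** Let S(n) be the sum of (A(n) - A(n - a)) / a over a <= n. Because of
    1 / (a (n + 1 - a)) = (1 / a + 1 / (n + 1 - a)) / (n + 1), all harmonic numbers
    cancel in S(n + 1) - S(n), except for a difference A(n + 1) - A(n). *)
Lemma corner_sum_inv (R : realType) n :
  corner_sum n (fun a b => a%:R^-1 * b%:R^-1) = B R n.
Proof.
have E a k : (a <= k)%N -> \sum_(k.+1 - a <= b < k.+1) b%:R^-1 = A R k - A R (k - a).
  move=> ak; rewrite /A [X in _ = X - _](big_cat_nat (n := (k - a).+1)) //=; last by lia.
  by rewrite addrAC subrr add0r subSn.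
have D k : corner_sum k (fun a b => a%:R^-1 * b%:R^-1) =
    \sum_(1 <= a < k.+1) a%:R^-1 * (A R k - A R (k - a)).
  rewrite /corner_sum big_nat [RHS]big_nat; apply: eq_bigr => a /andP[a0 ak].
  by rewrite -mulr_sumr E.
have AS k : A R k.+1 = A R k + k.+1%:R^-1 by rewrite /A big_nat_recr.
rewrite D; elim: n => [|n IH]; first by rewrite /B !big_geq.
have nR : n.+1%:R != 0 :> R by rewrite pnatr_eq0.
rewrite big_nat_recr //= subnn [A R 0]big_geq // subr0.
have -> : B R n.+1 = B R n + (n.+1%:R ^+ 2)^-1 by rewrite /B big_nat_recr.
have -> : \sum_(1 <= a < n.+1) a%:R^-1 * (A R n.+1 - A R (n.+1 - a)) =
    \sum_(1 <= a < n.+1) (a%:R^-1 * (A R n - A R (n - a)) +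
      n.+1%:R^-1 * a%:R^-1 - n.+1%:R^-1 * (a%:R^-1 + (n.+1 - a)%:R^-1)).
  rewrite big_nat [RHS]big_nat; apply: eq_bigr => a /andP[a0 an].
  have aR : a%:R != 0 :> R by rewrite pnatr_eq0 -lt0n.
  rewrite subSn // !AS -subSn // natrB ?(ltnW an) //.
  have bR : n.+1%:R - a%:R != 0 :> R by rewrite -natrB ?pnatr_eq0 ?(ltnW an) //; lia.
  move: nR aR bR; move: (n.+1%:R) (a%:R) => x y x0 y0 xy.
  by field; rewrite x0 y0 xy.
rewrite sumrB big_split /= IH -!mulr_sumr big_split /= -/(A R n).
have -> : \sum_(1 <= a < n.+1) (n.+1 - a)%:R^-1 = A R n.
  rewrite big_nat_rev /=; apply: eq_big_nat => a /andP[a0 an].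
  by congr (_%:R^-1); lia.
by rewrite AS; move: (n.+1%:R) nR => x x0; field.
Qed.

(** Expand the square: by the symmetry of the corner, only the sums of 1, 1 / a,
    b / a and 1 / (a b) over it are needed. *)
Lemma sum_corner_square (R : realType) n :
  \sum_(1 <= a < n.+1) \sum_(1 <= b < n.+1)
     (a + b - n.+1)%:R ^+ 2 / (a * b)%:R =
  2 * n%:R ^+ 2 - n%:R * (n%:R - 1) / 2 + n%:R * (n%:R + 1)
  + (n%:R + 1) ^+ 2 * B R n - 4 * (n%:R + 1) * n%:R :> R.
Proof.
pose D f := @corner_sum R n f; pose m : R := n.+1%:R.
have -> : \sum_(1 <= a < n.+1) \sum_(1 <= b < n.+1) (a + b - n.+1)%:R ^+ 2 / (a * b)%:R =
    D (fun a b => (a%:R + b%:R - m) ^+ 2 / (a * b)%:R).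
  rewrite /D /corner_sum big_nat [RHS]big_nat; apply: eq_bigr => a /andP[a0 an].
  rewrite (big_cat_nat (n := (n.+1 - a)%N)) /=; [|lia|lia].
  rewrite [X in X + _]big_nat [X in X + _]big1 ?add0r; last first.
    move=> b ?; rewrite (_ : (a + b - n.+1 = 0)%N) ?expr0n ?mul0r //; lia.
  rewrite big_nat [RHS]big_nat; apply: eq_bigr => b ?.
  by rewrite natrB ?natrD //; lia.
have DD f g : D (fun a b => f a b + g a b) = D f + D g.
  by rewrite /D /corner_sum -big_split; apply: eq_bigr => a _; rewrite -big_split.
have DZ x f : D (fun a b => x * f a b) = x * D f.
  by rewrite /D /corner_sum mulr_sumr; apply: eq_bigr => a _; rewrite mulr_sumr.
have D1 : D (fun a b => 1) = n%:R * (n%:R + 1) / 2.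
  rewrite /D /corner_sum; transitivity (\sum_(1 <= a < n.+1) a%:R : R).
    rewrite big_nat [RHS]big_nat; apply: eq_bigr => a /andP[a0 an].
    by rewrite sumr_const_nat subKn // (ltnW an).
  by rewrite sum_natr // -natr1; field.
have Da : D (fun a b => a%:R^-1) = n%:R.
  rewrite /D /corner_sum; transitivity (\sum_(1 <= a < n.+1) 1 : R).
    rewrite big_nat [RHS]big_nat; apply: eq_bigr => a /andP[a0 an].
    rewrite sumr_const_nat subKn ?(ltnW an) // -[LHS]mulr_natr mulVf //.
    by rewrite pnatr_eq0 -lt0n.
  by rewrite sumr_const_nat subn1.
have Db : D (fun a b => b%:R^-1) = n%:R.
  by rewrite -Da; exact: (corner_sum_sym n (fun a b => a%:R^-1)).
have Dba : D (fun a b => b%:R / a%:R) = n%:R ^+ 2 - n%:R * (n%:R - 1) / 4.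
  rewrite /D /corner_sum.
  transitivity (\sum_(1 <= a < n.+1) (n%:R + 2^-1 - 2^-1 * a%:R) : R).
    rewrite big_nat [RHS]big_nat; apply: eq_bigr => a /andP[a0 an].
    have aR : a%:R != 0 :> R by rewrite pnatr_eq0 -lt0n.
    rewrite -mulr_suml sum_natr ?leq_subr // natrB ?(ltnW an) // -natr1.
    by field.
  rewrite sumrB sumr_const_nat -mulr_sumr sum_natr // subn1 /= -[_ *+ n]mulr_natl.
  by rewrite -natr1; field.
have Dab : D (fun a b => a%:R / b%:R) = n%:R ^+ 2 - n%:R * (n%:R - 1) / 4.
  by rewrite -Dba; exact: (corner_sum_sym n (fun a b => b%:R / a%:R)).
have Di : D (fun a b => a%:R^-1 * b%:R^-1) = B R n := corner_sum_inv R n.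
transitivity (D (fun a b => a%:R / b%:R + b%:R / a%:R + 2 * 1 + m ^+ 2 * (a%:R^-1 * b%:R^-1)
   + - 2 * m * a%:R^-1 + - 2 * m * b%:R^-1)).
  rewrite /D /corner_sum big_nat [RHS]big_nat; apply: eq_bigr => a /andP[a0 an].
  rewrite big_nat [RHS]big_nat; apply: eq_bigr => b /andP[b0 bn].
  have aR : a%:R != 0 :> R by rewrite pnatr_eq0 -lt0n.
  have bR : b%:R != 0 :> R by rewrite pnatr_eq0; lia.
  by rewrite natrM; field; rewrite aR bR.
rewrite !DD !DZ D1 Da Db Dba Dab Di /m -natr1.
by field.
Qed.

(** By symmetry, the cube [1, n + 1]^3 is [1, n]^3 with three faces, three edges and
    a vertex, on all of which the largest coefficient is n + 1. *)
Lemma F_sum3_density (R : realType) n : F R n = 2 * sum3 n (density R).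
Proof.
elim: n => [|n IH].
  by rewrite /sum3 big_geq // /F /A /B !big_geq // expr0n /= !mulr0 subr0 addr0.
rewrite sum3_recr; last 2 first.
- exact: density_swap12.
- exact: density_swap23.
have nR : n.+1%:R != 0 :> R by rewrite pnatr_eq0.
have -> : \sum_(1 <= a < n.+1) \sum_(1 <= b < n.+1) density R a b n.+1 =
   n%:R ^+ 2 * (4 / n.+1%:R) - n.+1%:R^-1 * (\sum_(1 <= a < n.+1) \sum_(1 <= b < n.+1)
     (a + b - n.+1)%:R ^+ 2 / (a * b)%:R).
  transitivity (\sum_(1 <= a < n.+1) \sum_(1 <= b < n.+1) (4 / n.+1%:R -
     n.+1%:R^-1 * ((a + b - n.+1)%:R ^+ 2 / (a * b)%:R)) : R).
    rewrite big_nat [RHS]big_nat; apply: eq_bigr => a /andP[a0 an].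
    rewrite big_nat [RHS]big_nat; apply: eq_bigr => b /andP[b0 bn].
    rewrite /density; have -> : maxn a (maxn b n.+1) = n.+1 by lia.
    have -> : (a + b + n.+1 - 2 * n.+1 = a + b - n.+1)%N by lia.
    by congr (_ - _); rewrite (natrM _ (a * b)%N) invfM [LHS]mulrA [LHS]mulrC.
  under eq_bigr => a _ do rewrite sumrB sumr_const_nat subn1 /= -mulr_sumr.
  rewrite sumrB sumr_const_nat subn1 /= -mulr_sumr -mulrnA -[_ *+ (n * n)]mulr_natl.
  by rewrite natrM expr2.
have -> : \sum_(1 <= a < n.+1) density R a n.+1 n.+1 =
   n%:R * (4 / n.+1%:R) - n%:R / (2 * n.+1%:R).
  transitivity (\sum_(1 <= a < n.+1) (4 / n.+1%:R - (n.+1%:R ^+ 2)^-1 * a%:R) : R).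
    rewrite big_nat [RHS]big_nat; apply: eq_bigr => a /andP[a0 an].
    have aR : a%:R != 0 :> R by rewrite pnatr_eq0 -lt0n.
    rewrite /density; have -> : maxn a (maxn n.+1 n.+1) = n.+1 by lia.
    have -> : (a + n.+1 + n.+1 - 2 * n.+1 = a)%N by lia.
    by rewrite !natrM; move: (n.+1%:R) nR => x x0; field; rewrite x0 aR.
  rewrite sumrB sumr_const_nat -mulr_sumr sum_natr // subn1 /= -[_ *+ n]mulr_natl.
  by move: nR; rewrite -natr1 => nR; field.
have -> : density R n.+1 n.+1 n.+1 = 3 / n.+1%:R.
  rewrite /density !maxnn; have -> : (n.+1 + n.+1 + n.+1 - 2 * n.+1 = n.+1)%N by lia.
  by rewrite !natrM; move: (n.+1%:R) nR => x x0; field.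
rewrite sum_corner_square !mulrDr -IH /F.
have -> : A R n.+1 = A R n + n.+1%:R^-1 by rewrite /A big_nat_recr.
have -> : B R n.+1 = B R n + (n.+1%:R ^+ 2)^-1 by rewrite /B big_nat_recr.
by move: nR; rewrite -natr1 => nR; field.
Qed.

(** * Signs of the coordinates *)

(** A pair of coordinates (x_i, y_i) with x_i nonzero is encoded by the sign of x_i,
    |x_i| - 1 and s y_i + L, where s = 1 or - 1 is that sign. The product x_i y_i,
    hence the equation, does not involve the sign. *)
Definition coord_code (n L : nat) : finType := (bool * 'I_n * 'I_(2 * L).+1)%type.

Definition code_abs n L (k : coord_code n L) : nat := (k.1.2 : nat).+1.
Definition code_shift n L (k : coord_code n L) : nat := k.2.

Definition decode_x n L (k : coord_code n L) : int := (-1) ^+ k.1.1 * (code_abs k)%:Z.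
Definition decode_y n L (k : coord_code n L) : int := (-1) ^+ k.1.1 * ((code_shift k)%:Z - L%:Z).

Lemma decode_inj n L (k k' : coord_code n L) : decode_x k = decode_x k' -> decode_y k = decode_y k' -> k = k'.
Proof.
case: k k' => [[s a] u] [[s' a'] u']; rewrite /decode_x /decode_y /code_abs /code_shift /= => ex.
have aa : a = a'.
  apply: val_inj; have /= := congr1 absz ex; rewrite !abszM !abszX /=.
  by rewrite !exp1n !mul1n => -[].
have ss : s = s'.
  by move: ex; rewrite aa; case: s; case: s'; rewrite ?expr1 ?expr0 ?mul1r ?mulN1r //; lia.
rewrite ss aa => /(mulfI _) ey; congr (_, _); apply: val_inj.
have : u%:Z - L%:Z = u'%:Z - L%:Z by apply: ey; rewrite signr_eq0.
by move=> /(addIr _) [].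
Qed.

Lemma decode_mul n L (k : coord_code n L) : decode_x k * decode_y k =
  (code_abs k * code_shift k)%N%:Z - (code_abs k * L)%N%:Z.
Proof.
by rewrite /decode_x /decode_y mulrACA -expr2 sqrr_sign mul1r mulrBr !PoszM.
Qed.

Lemma decode_y_eq0 n L (k : coord_code n L) : (decode_y k == 0) = (code_shift k == L).
Proof. by rewrite /decode_y mulf_eq0 signr_eq0 /= subr_eq0. Qed.

Lemma decode_x_neq0 n L (k : coord_code n L) : decode_x k != 0.
Proof. by rewrite /decode_x mulf_eq0 signr_eq0. Qed.

Lemma decode_x_abs n L (k : coord_code n L) : (`|decode_x k| <= n)%N.
Proof. by rewrite /decode_x abszM abszX /= exp1n mul1n; exact: ltn_ord. Qed.

Lemma decode_y_abs n L (k : coord_code n L) : (`|decode_y k| <= L)%N.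
Proof.
rewrite /decode_y abszM abszX /= exp1n mul1n /code_shift.
by case: k => [? [u ult]] /=; lia.
Qed.

Lemma decode_surj n L (x y : int) : x != 0 -> (`|x| <= n)%N -> (`|y| <= L)%N ->
  exists k : coord_code n L, decode_x k = x /\ decode_y k = y.
Proof.
move=> x0 xn yL.
have xlt : (`|x|.-1 < n)%N by rewrite prednK ?absz_gt0.
have ylt : (`|((-1) ^+ (x < 0)%R * y + L%:Z)%R| < (2 * L).+1)%N by case: (x < 0); rewrite /= ?expr1 ?expr0 ?mulN1r ?mul1r; lia.
exists (x < 0, Ordinal xlt, Ordinal ylt); rewrite /decode_x /decode_y /code_abs /code_shift /=; split.
  rewrite prednK ?absz_gt0 //; by case: ltP => h; rewrite /= ?expr1 ?expr0 ?mulN1r ?mul1r; lia.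
rewrite gez0_abs ?addrK; last by case: (x < 0); rewrite /= ?expr1 ?expr0 ?mulN1r ?mul1r; lia.
by rewrite mulrA -expr2 sqrr_sign mul1r.
Qed.

Definition row3 (x y z : int) : 'rV[int]_3 := \row_i [:: x; y; z]`_i.

Lemma forall_ord3 (P : 'I_3 -> Prop) :
  (forall i, P i) <-> [/\ P ord0, P (inord 1) & P (inord 2)].
Proof.
split=> [h|[h0 h1 h2] i]; first by split.
case: i => [[|[|[|//]]] hi].
- by rewrite (_ : Ordinal hi = ord0) //; apply: val_inj.
- by rewrite (_ : Ordinal hi = inord 1) //; apply: val_inj; rewrite /= inordK.
- by rewrite (_ : Ordinal hi = inord 2) //; apply: val_inj; rewrite /= inordK.
Qed.

Lemma row3E x y z :
  [/\ row3 x y z 0 ord0 = x, row3 x y z 0 (inord 1) = y & row3 x y z 0 (inord 2) = z].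
Proof. by split; rewrite mxE ?inordK. Qed.

Lemma row3_eta (v : 'rV[int]_3) : v = row3 (v 0 ord0) (v 0 (inord 1)) (v 0 (inord 2)).
Proof.
apply/rowP/forall_ord3; split; by rewrite mxE ?inordK.
Qed.

Lemma sum_ord3 (f : 'I_3 -> int) : \sum_(i < 3) f i = f ord0 + f (inord 1) + f (inord 2).
Proof.
rewrite !big_ord_recl big_ord0 addr0 addrA; congr (_ + f _ + f _);
  by apply: val_inj; rewrite /= inordK.
Qed.

Lemma supnorm_le (x : 'rV[int]_3) m :
  (supnorm x <= m)%N <-> forall i, (`|x 0%R i| <= m)%N.
Proof.
rewrite /supnorm; split=> [/bigmax_leqP h i|h]; first exact: h.
by apply/bigmax_leqP => i _; exact: h.
Qed.

Definition decode n L (k : coord_code n L * coord_code n L * coord_code n L) :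
    'rV[int]_3 * 'rV[int]_3 :=
  (row3 (decode_x k.1.1) (decode_x k.1.2) (decode_x k.2),
   row3 (decode_y k.1.1) (decode_y k.1.2) (decode_y k.2)).

Lemma decode_triple_inj n L : injective (@decode n L).
Proof.
move=> [[k1 k2] k3] [[l1 l2] l3] [].
have [a1 a2 a3] := row3E (decode_x k1) (decode_x k2) (decode_x k3).
have [b1 b2 b3] := row3E (decode_x l1) (decode_x l2) (decode_x l3).
have [c1 c2 c3] := row3E (decode_y k1) (decode_y k2) (decode_y k3).
have [d1 d2 d3] := row3E (decode_y l1) (decode_y l2) (decode_y l3).
move=> /= ex ey.
have [x1 x2 x3] : [/\ decode_x k1 = decode_x l1, decode_x k2 = decode_x l2 &
    decode_x k3 = decode_x l3].
  by rewrite ex b1 b2 b3 in a1 a2 a3; split.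
have [y1 y2 y3] : [/\ decode_y k1 = decode_y l1, decode_y k2 = decode_y l2 &
    decode_y k3 = decode_y l3].
  by rewrite ey d1 d2 d3 in c1 c2 c3; split.
by rewrite (decode_inj x1 y1) (decode_inj x2 y2) (decode_inj x3 y3).
Qed.

Definition code_sol n L (k : coord_code n L * coord_code n L * coord_code n L) : bool :=
  [&& code_shift k.1.1 != L, code_shift k.1.2 != L, code_shift k.2 != L &
   code_abs k.1.1 * code_shift k.1.1 + code_abs k.1.2 * code_shift k.1.2
     + code_abs k.2 * code_shift k.2 ==
     (code_abs k.1.1 + code_abs k.1.2 + code_abs k.2) * L]%N.

Lemma decode_sol (R : realType) (X Y : R) k : 0 <= X -> 0 <= Y ->
  Msol X Y (@decode (Num.truncn X) (Num.truncn Y) k) <-> code_sol k.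
Proof.
move=> X0 Y0; case: k => [[k1 k2] k3]; rewrite /Msol /decode /=.
have [a1 a2 a3] := row3E (decode_x k1) (decode_x k2) (decode_x k3).
have [c1 c2 c3] := row3E (decode_y k1) (decode_y k2) (decode_y k3).
have Xle : (supnorm (row3 (decode_x k1) (decode_x k2) (decode_x k3)))%:R <= X.
  rewrite -truncn_ge_nat //; apply/supnorm_le/forall_ord3.
  by rewrite a1 a2 a3; split; exact: decode_x_abs.
have Yle : (supnorm (row3 (decode_y k1) (decode_y k2) (decode_y k3)))%:R <= Y.
  rewrite -truncn_ge_nat //; apply/supnorm_le/forall_ord3.
  by rewrite c1 c2 c3; split; exact: decode_y_abs.
have EQ : (\sum_(i < 3) row3 (decode_x k1) (decode_x k2) (decode_x k3) 0 i *
   row3 (decode_y k1) (decode_y k2) (decode_y k3) 0 i == 0) =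
   (code_abs k1 * code_shift k1 + code_abs k2 * code_shift k2
     + code_abs k3 * code_shift k3 ==
     (code_abs k1 + code_abs k2 + code_abs k3) * (Num.truncn Y))%N.
  rewrite sum_ord3 a1 a2 a3 c1 c2 c3 !decode_mul !mulnDl.
  move: (code_abs k1 * code_shift _)%N (code_abs k2 * code_shift _)%N.
  move: (code_abs k3 * code_shift _)%N (code_abs k1 * _)%N (code_abs k2 * _)%N.
  move: (code_abs k3 * _)%N; clear => *.
  by apply/eqP/eqP; lia.
split=> [[_ /forall_ord3 [y1 y2 y3] e _ _]|/and4P[y1 y2 y3 e]].
  move: y1 y2 y3; rewrite c1 c2 c3 !decode_y_eq0 => y1 y2 y3.
  by apply/and4P; split=> //=; rewrite -EQ e.
split=> //.
- by apply/forall_ord3; rewrite a1 a2 a3; split; exact: decode_x_neq0.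
- by apply/forall_ord3; rewrite c1 c2 c3 !decode_y_eq0.
- by apply/eqP; rewrite EQ.
Qed.

Lemma M_card (R : realType) (X Y : R) : 0 <= X -> 0 <= Y ->
  M X Y = #|[pred k | @code_sol (Num.truncn X) (Num.truncn Y) k]|.
Proof.
move=> X0 Y0; pose S := [pred k | @code_sol (Num.truncn X) (Num.truncn Y) k].
rewrite /M.
have -> : fset_set (Msol X Y) = [fset (decode k) | k in S]%fset.
  apply/fsetP => z; rewrite in_fset_set; last exact: finite_Msol.
  apply/idP/imfsetP => [|[k /= kS ->]]; last by rewrite in_setE; apply/decode_sol.
  rewrite in_setE => zS; have [/forall_ord3 [x1 x2 x3] _ _ sX sY] := zS.
  have /supnorm_le/forall_ord3 [X1 X2 X3] : (supnorm z.1 <= Num.truncn X)%N.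
    by rewrite truncn_ge_nat.
  have /supnorm_le/forall_ord3 [Y1 Y2 Y3] : (supnorm z.2 <= Num.truncn Y)%N.
    by rewrite truncn_ge_nat.
  have [k1 [kx1 ky1]] := decode_surj x1 X1 Y1.
  have [k2 [kx2 ky2]] := decode_surj x2 X2 Y2.
  have [k3 [kx3 ky3]] := decode_surj x3 X3 Y3.
  have zE : z = decode (k1, k2, k3).
    rewrite /decode /= kx1 kx2 kx3 ky1 ky2 ky3 -!row3_eta.
    by case: (z).
  by exists (k1, k2, k3) => //; apply/decode_sol => //; rewrite -zE.
rewrite card_imfset; last exact: decode_triple_inj.
by rewrite cardE.
Qed.

(** The three signs are free, whence the factor 8. *)
Lemma card_code_sol n L :
  #|[pred k | @code_sol n L k]| = (8 * \sum_(a < n) \sum_(b < n) \sum_(c < n) nonzero_count a.+1 b.+1 c.+1 L)%N.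
Proof.
pose P a b c u v t := [&& u != L, v != L, t != L &
  a.+1 * u + b.+1 * v + c.+1 * t == (a.+1 + b.+1 + c.+1) * L]%N.
have split (f : coord_code n L -> nat) : (forall s a u, f (s, a, u) = f (true, a, u)) ->
    (\sum_k f k = 2 * \sum_(a < n) \sum_(u < (2 * L).+1) f (true, a, u))%N.
  move=> fs.
  transitivity (\sum_(k : bool * 'I_n * 'I_(2 * L).+1) f k)%N; first by [].
  transitivity (\sum_(sa : bool * 'I_n) \sum_(u < (2 * L).+1) f (sa, u))%N.
    by rewrite pair_bigA; apply: eq_bigr => -[sa u].
  transitivity (\sum_(s : bool) \sum_(a < n) \sum_(u < (2 * L).+1) f (s, a, u))%N.
    by rewrite [RHS]pair_bigA; apply: eq_bigr => -[s a].
  rewrite big_bool [RHS]mul2n -[RHS]addnn; congr (_ + _)%N.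
  by apply: eq_bigr => a _; apply: eq_bigr => u _; rewrite fs.
pose g k1 k2 k3 : nat := @code_sol n L (k1, k2, k3).
transitivity (\sum_k1 \sum_k2 \sum_k3 g k1 k2 k3)%N.
  rewrite pair_bigA /= pair_bigA /= -sum1_card big_mkcond /=.
  apply: eq_bigr => k _; rewrite inE /g.
  by case: k => [[k1 k2] k3] /=; case: (code_sol _).
have pull m1 m2 (F : 'I_m1 -> 'I_m2 -> nat) :
    (\sum_a \sum_u (2 * F a u) = 2 * \sum_a \sum_u F a u)%N.
  by rewrite big_distrr /=; apply: eq_bigr => a _; rewrite big_distrr.
rewrite split //.
under eq_bigr => a _ do (under eq_bigr => u _ do rewrite split //).
under eq_bigr => a _ do (under eq_bigr => u _ do
  (under eq_bigr => b _ do (under eq_bigr => v _ do rewrite split //))).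
under eq_bigr => a _ do (under eq_bigr => u _ do rewrite pull mulnA).
rewrite [in RHS](_ : 8 = 2 * 4)%N // -[RHS]mulnA; congr (2 * _)%N.
rewrite [RHS]big_distrr /=; apply: eq_bigr => a _.
rewrite -big_distrr /=; congr (4 * _)%N.
rewrite exchange_big /=; apply: eq_bigr => b _.
transitivity (\sum_(u < (2 * L).+1) \sum_(c < n) \sum_(v < (2 * L).+1)
    \sum_(t < (2 * L).+1) g (true, a, u) (true, b, v) (true, c, t))%N.
  by apply: eq_bigr => u _; rewrite exchange_big.
by rewrite exchange_big.
Qed.

(** * The main term and the theorem *)

Lemma truncn_divn (R : realType) (X : R) q : 0 <= X -> (0 < q)%N ->
  Num.truncn (X / q%:R) = (Num.truncn X %/ q)%N.
Proof.
move=> X0 q0; have qR : 0 < q%:R :> R by rewrite ltr0n.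
apply/eqP; rewrite truncn_eq ?divr_ge0 //.
rewrite ler_pdivlMr // ltr_pdivrMr // -!natrM.
rewrite -truncn_ge_nat // -truncn_lt_nat // leq_trunc_div /=.
by rewrite ltn_ceil.
Qed.

Lemma main_series_finite (R : realType) (X : R) : 0 <= X ->
  limn (fun n : nat => \sum_(1 <= q < n)
    ((totient q)%:R / q%:R * F R (Num.truncn (X / q%:R)))) =
  \sum_(1 <= q < (Num.truncn X).+1)
    ((totient q)%:R / q%:R * F R (Num.truncn X %/ q)).
Proof.
move=> X0; set n := Num.truncn X; apply: lim_near_cst => //.
have E q : (0 < q)%N -> Num.truncn (X / q%:R) = (n %/ q)%N by exact: truncn_divn.
exists n.+1 => // m /= nm.
rewrite (big_cat_nat (n := n.+1)) //= [X in _ + X]big_nat [X in _ + X]big1 ?addr0.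
  rewrite big_nat [RHS]big_nat; apply: eq_bigr => q /andP[q0 _].
  by rewrite E.
move=> q /andP[nq _]; rewrite E ?(leq_ltn_trans _ nq) // divn_small //.
by rewrite F_sum3_density /sum3 big_geq // !mulr0.
Qed.

Lemma sum3_multiples (R : numDomainType) n q (f : nat -> nat -> nat -> R) : (0 < q)%N ->
  sum3 (n %/ q) (fun a b c => f (q * a) (q * b) (q * c))%N =
  sum3 n (fun a b c => if (q %| gcd3 a b c)%N then f a b c else 0).
Proof.
move=> q0; have E (g : nat -> R) : \sum_(1 <= k < (n %/ q).+1) g (q * k)%N =
    \sum_(1 <= a < n.+1) if (q %| a)%N then g a else 0.
  by rewrite -big_mkcond sum_multiples.
rewrite /sum3 (E (fun a => \sum_(1 <= b < (n %/ q).+1) \sum_(1 <= c < (n %/ q).+1)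
  f a (q * b)%N (q * c)%N)); apply: eq_bigr => a _.
case: ifP => qa; last first.
  by rewrite big1 // => b _; rewrite big1 // => c _; rewrite !dvdn_gcd qa andbF.
rewrite (E (fun b => \sum_(1 <= c < (n %/ q).+1) f a b (q * c)%N)).
apply: eq_bigr => b _; case: ifP => qb; last first.
  by rewrite big1 // => c _; rewrite !dvdn_gcd qb.
rewrite (E (f a b)); apply: eq_bigr => c _.
by rewrite !dvdn_gcd qa qb.
Qed.

Lemma sum_totient_upto m n : (0 < m <= n)%N ->
  (\sum_(1 <= d < n.+1 | d %| m) totient d = m)%N.
Proof.
move=> /andP[m0 mn]; rewrite -[RHS](sum_totient_dvd m).
rewrite (big_cat_nat (n := m.+1)) //= [X in (_ + X)%N]big_nat_cond.
rewrite [X in (_ + X)%N]big1 ?addn0; last first.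
  move=> d /andP[/andP[md _] /(dvdn_leq m0)]; by rewrite leqNgt md.
rewrite -(big_mkord (fun d => d %| m)%N) [RHS]big_mkcond big_nat_recl //=.
by rewrite dvd0n gtn_eqF //= add0n big_add1 /= -big_mkcond.
Qed.

(** The sum of phi(q) over the divisors q of the gcd is the gcd, and the density is
    homogeneous of degree - 1. *)
Lemma main_term_sum3 (R : realType) n :
  \sum_(1 <= q < n.+1) ((totient q)%:R / q%:R * F R (n %/ q)) =
  2 * sum3 n (fun a b c => (gcd3 a b c)%:R * density R a b c).
Proof.
transitivity (\sum_(1 <= q < n.+1) sum3 n (fun a b c =>
    if (q %| gcd3 a b c)%N then 2 * (totient q)%:R * density R a b c else 0)).
  rewrite big_nat [RHS]big_nat; apply: eq_bigr => q /andP[q0 _].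
  have qR : q%:R != 0 :> R by rewrite pnatr_eq0 -lt0n.
  rewrite -(sum3_multiples n (fun a b c => 2 * (totient q)%:R * density R a b c) q0).
  rewrite F_sum3_density sum3_mulr.
  have -> : sum3 (n %/ q) (density R) =
      sum3 (n %/ q) (fun a b c => q%:R * density R (q * a) (q * b) (q * c)).
    by apply: eq_sum3 => a b c _ _ _; rewrite density_mul.
  rewrite sum3_mulr; field; exact: qR.
rewrite -sum3_mulr /sum3 exchange_big /= big_nat [RHS]big_nat.
apply: eq_bigr => a /andP[a0 an]; rewrite exchange_big /= big_nat [RHS]big_nat.
apply: eq_bigr => b /andP[b0 bn]; rewrite exchange_big /=.
apply: eq_bigr => c _; rewrite -big_mkcond /= -mulr_suml -mulr_sumr -mulrA.
rewrite -natr_sum sum_totient_upto // gcdn_gt0 b0 /=.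
by rewrite (leq_trans (dvdn_leq b0 (dvdn_gcdl _ _))).
Qed.

(** Induction with ln (1 - 1 / (n + 1)) <= - 1 / (n + 1). *)
Lemma A_le_ln (R : realType) n : (0 < n)%N -> A R n <= 1 + ln n%:R.
Proof.
elim: n => // n IH _; have [->|n0] := posnP n.
  by rewrite /A big_nat1 invr1 ln1 addr0.
have -> : A R n.+1 = A R n + n.+1%:R^-1 by rewrite /A big_nat_recr.
apply: le_trans (lerD (IH n0) (lexx _)) _; rewrite -addrA lerD2l.
have nR : 0 < n%:R :> R by rewrite ltr0n.
have mR : 0 < n.+1%:R :> R by rewrite ltr0n.
have E : n%:R = n.+1%:R * (1 + - n.+1%:R^-1) :> R.
  by rewrite mulrDr mulr1 mulrN divff ?gt_eqF // -[n.+1%:R]natr1 addrK.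
have p : 0 < 1 + - n.+1%:R^-1 :> R by rewrite -(pmulr_rgt0 _ mR) -E.
rewrite [in ln n%:R]E lnM ?posrE //.
have : ln (1 + - n.+1%:R^-1) <= - n.+1%:R^-1 :> R.
  apply: le_ln1Dx; rewrite ltrN2 invf_lt1 //.
  by rewrite (ltr_nat R 1) ltnS.
by move=> h; rewrite -addrA gerDl -lerBrDr sub0r.
Qed.

Theorem theorem1 (R : realType) :
  exists C : R, forall X Y : R, 3%:R / 2%:R <= X -> X <= Y ->
    `|(M X Y)%:R - 4%:R * Y ^+ 2 *
        limn (fun n : nat => \sum_(1 <= q < n)
          ((totient q)%:R / q%:R * F R (Num.truncn (X / q%:R))))|
      <= C * ((X * Y) `^ (3%:R / 2%:R) * ln X * ln Y).
Proof.
(* A(n) <= 1 + ln n <= K ln X, because ln X is bounded below by ln (3 / 2). *)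
pose K : R := 1 + (ln (3 / 2))^-1.
(* 11296 = 8 (2 . 702 + 8): the factor 702 applies to both n^3 and n^2 L, and
   replacing L^2 by Y^2 in the main term costs 8 n^2 Y A(n)^2. *)
exists (11296 * K ^+ 2) => X Y X32 XY.
have X1 : 1 <= X by lra.
have X0 : 0 <= X by lra.
have Y0 : 0 <= Y by lra.
rewrite main_series_finite // main_term_sum3 M_card // card_code_sol.
set n := Num.truncn X; set L := Num.truncn Y.
have n0 : (0 < n)%N by rewrite truncn_gt0.
have nX : n%:R <= X by rewrite truncn_le.
have LY : L%:R <= Y by rewrite truncn_le.
have YL : Y < L%:R + 1 by rewrite natr1; case/andP: (truncn_itv Y0).
set S := sum3 n (fun a b c => (gcd3 a b c)%:R * density R a b c).
pose N3 := sum3 n (fun a b c => (nonzero_count a b c L)%:R : R).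
have -> : (8 * \sum_(a < n) \sum_(b < n) \sum_(c < n)
    nonzero_count a.+1 b.+1 c.+1 L)%N%:R = 8 * N3.
  rewrite natrM natr_sum /N3 /sum3 big_add1 /= big_mkord; congr (_ * _).
  apply: eq_bigr => a _; rewrite natr_sum big_add1 /= big_mkord.
  apply: eq_bigr => b _; rewrite natr_sum big_add1 /= big_mkord.
  by [].
have H1 : `|N3 - L%:R ^+ 2 * S| <= 702 * ((n%:R ^+ 3 + n%:R ^+ 2 * L%:R) * A R n ^+ 2).
  apply: le_trans (total_count_bound R n L).
  rewrite /N3 /S -sum3_mulr -mulN1r -sum3_mulr -sum3D /sum3.
  apply: le_trans (ler_norm_sum _ _ _) _; apply: ler_sum => a _.
  apply: le_trans (ler_norm_sum _ _ _) _; apply: ler_sum => b _.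
  apply: le_trans (ler_norm_sum _ _ _) _; apply: ler_sum => c _.
  by rewrite mulN1r.
have /andP[S0 S4] := sum3_density R n; rewrite -/S in S0 S4.
have H2 : 0 <= (Y ^+ 2 - L%:R ^+ 2) * S <= 8 * (n%:R ^+ 2 * Y * A R n ^+ 2).
  have L0 : 0 <= L%:R :> R by [].
  have D0 : 0 <= Y ^+ 2 - L%:R ^+ 2 by rewrite subr_ge0 lerXn2r ?nnegrE.
  have D2 : Y ^+ 2 - L%:R ^+ 2 <= 2 * Y by rewrite subr_sqr; nra.
  rewrite mulr_ge0 //=.
  apply: le_trans (ler_pM D0 S0 D2 S4) _.
  by rewrite le_eqVlt; apply/orP; left; apply/eqP; ring.
pose P := (X * Y) `^ (3%:R / 2%:R).
have P1 : X ^+ 2 * Y <= P.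
  have XY0 : 0 <= X * Y by rewrite mulr_ge0.
  have -> : P = (X * Y) * (X * Y) `^ (2^-1).
    rewrite /P (_ : 3%:R / 2%:R = 1 + 2^-1 :> R); last by field.
    rewrite powRD ?powRr1 //; apply/implyP => _; rewrite gt_eqF //.
    by rewrite mulr_gt0; lra.
  rewrite expr2 -mulrA mulrC ler_wpM2l //.
  have XE : (X ^+ 2) `^ 2^-1 = X.
    by rewrite -powR_mulrn // -powRrM divff // powRr1.
  rewrite -{1}XE; apply: ge0_ler_powR; rewrite ?nnegrE ?exprn_ge0 //.
  by rewrite expr2 ler_wpM2l.
have A0 := A_ge0 R n.
have B1 : n%:R ^+ 2 * L%:R <= P.
  by apply: le_trans P1; rewrite ler_pM ?exprn_ge0 // lerXn2r ?nnegrE.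
have B2 : n%:R ^+ 2 * Y <= P.
  by apply: le_trans P1; rewrite ler_wpM2r // lerXn2r ?nnegrE.
have B3 : n%:R ^+ 3 <= P.
  by apply: le_trans B2; rewrite exprSr ler_wpM2l ?exprn_ge0 // (le_trans nX).
have P0 : 0 <= P by apply: powR_ge0.
have lnX : 0 < ln (3 / 2) :> R by rewrite ln_gt0 //; lra.
have lX : ln (3 / 2) <= ln X by rewrite ler_ln ?posrE //; lra.
have lXY : ln X <= ln Y by rewrite ler_ln ?posrE //; lra.
have lX0 : 0 < ln X by apply: lt_le_trans lX.
have AK : A R n <= K * ln X.
  apply: le_trans (A_le_ln R n0) _; rewrite /K mulrDl mul1r addrC lerD //.
    by rewrite ler_ln ?posrE ?ltr0n //; lra.
  by rewrite mulrC ler_pdivlMr // mul1r.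
have K0 : 0 <= K by rewrite /K addr_ge0 // invr_ge0 ltW.
have A2 : A R n ^+ 2 <= K ^+ 2 * (ln X * ln Y).
  apply: le_trans (_ : (K * ln X) ^+ 2 <= _).
    by rewrite lerXn2r ?nnegrE // mulr_ge0 // ltW.
  by rewrite exprMn ler_wpM2l ?exprn_ge0 // expr2 ler_wpM2l // ltW.
have A20 : 0 <= A R n ^+ 2 by rewrite exprn_ge0.
rewrite -/P (_ : _ - _ = 8 * ((N3 - L%:R ^+ 2 * S) - (Y ^+ 2 - L%:R ^+ 2) * S)); last by ring.
rewrite normrM (ger0_norm (_ : 0 <= 8)) //.
apply: le_trans (_ : 8 * (1412 * (P * A R n ^+ 2)) <= _).
  rewrite ler_pM2l //; apply: le_trans (ler_normB _ _) _.
  case/andP: H2 => H20 H2; rewrite (ger0_norm H20).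
  have E1 := ler_wpM2r A20 B1; have E2 := ler_wpM2r A20 B2; have E3 := ler_wpM2r A20 B3.
  apply: le_trans (lerD H1 H2) _; rewrite mulrDl.
  lra.
rewrite (_ : 11296 * _ * _ = 8 * (1412 * (P * (K ^+ 2 * (ln X * ln Y))))); last by ring.
apply: ler_wpM2l; first exact: ler0n.
apply: ler_wpM2l; first exact: ler0n.
exact: ler_wpM2l.
Qed.
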